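(* Consider problem (P): $\min_{x\in H} f(x)+g(x)+\sum_{i=1}^m h_i(B_ix)$ under the standing assumptions below. Let $w_1,\dots,w_m\in(0,1)$ with $\sum_{i=1}^m w_i=1$, let $\gamma\in(0,2/L)$ and $0<\lambda<1/\sum_{i=1}^m w_i\|B_i\|^2$. Given arbitrary $x^0\in H$ and $y_i^0\in G_i$ ($i=1,\dots,m$), define for $k\ge0$ $$v^k=\operatorname{prox}_{\gamma g}\Big(x^k-\gamma\nabla f(x^k)-\gamma\sum_{i=1}^m w_iB_i^*y_i^k\Big),$$ $$y_i^{k+1}=\tfrac1{w_i}\operatorname{prox}_{w_i\frac{\lambda}{\gamma}h_i^*}\Big(w_i\big(y_i^k+\tfrac{\lambda}{\gamma}B_iv^k\big)\Big),\quad i=1,\dots,m,$$ $$x^{k+1}=\operatorname{prox}_{\gamma g}\Big(x^k-\gamma\nabla f(x^k)-\gamma\sum_{i=1}^m w_iB_i^*y_i^{k+1}\Big).$$ Then $\{x^k\}$ converges weakly to a solution of (P).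
   Context: Standing assumptions: $H$ and $G_1,\dots,G_m$ are real Hilbert spaces; $f:H\to\mathbb R$ is convex and differentiable with $L$-Lipschitz continuous gradient for some $L\in(0,\infty)$; $g\in\Gamma_0(H)$; $h_i\in\Gamma_0(G_i)$ and $B_i:H\to G_i$ is a bounded linear operator for each $i$; there exists $\hat x\in H$ with $0\in\nabla f(\hat x)+\partial g(\hat x)+\sum_{i=1}^m B_i^*\partial h_i(B_i\hat x)$. $\Gamma_0(X)$ is the set of proper lsc convex functions on $X$; $\operatorname{prox}_{\lambda\varphi}(u)=\arg\min_x\{\tfrac12\|x-u\|^2+\lambda\varphi(x)\}$; $\varphi^*$ is the Fenchel conjugate; $B_i^*$ is the adjoint of $B_i$ and $\|B_i\|$ its operator norm. *)

(* Defs.v *)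
From Stdlib Require Import Reals Lra ClassicalEpsilon.
Open Scope R_scope.
Set Implicit Arguments.

Record Hilbert := MkHilbert {
  car :> Type;
  hzero : car;
  hadd : car -> car -> car;
  hopp : car -> car;
  hscal : R -> car -> car;
  inner : car -> car -> R;
  hadd_assoc : forall x y z, hadd x (hadd y z) = hadd (hadd x y) z;
  hadd_comm : forall x y, hadd x y = hadd y x;
  hadd_zero : forall x, hadd x hzero = x;
  hadd_opp : forall x, hadd x (hopp x) = hzero;
  hscal_one : forall x, hscal 1 x = x;
  hscal_assoc : forall a b x, hscal a (hscal b x) = hscal (a * b) x;
  hscal_distr_l : forall a x y, hscal a (hadd x y) = hadd (hscal a x) (hscal a y);
  hscal_distr_r : forall a b x, hscal (a + b) x = hadd (hscal a x) (hscal b x);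
  inner_sym : forall x y, inner x y = inner y x;
  inner_add : forall x y z, inner (hadd x y) z = inner x z + inner y z;
  inner_scal : forall a x y, inner (hscal a x) y = a * inner x y;
  inner_pos : forall x, 0 <= inner x x;
  inner_def : forall x, inner x x = 0 -> x = hzero;
  complete : forall u : nat -> car,
    (forall eps, 0 < eps -> exists N, forall n p, (n >= N)%nat -> (p >= N)%nat ->
        sqrt (inner (hadd (u n) (hopp (u p))) (hadd (u n) (hopp (u p)))) < eps) ->
    exists l, forall eps, 0 < eps -> exists N, forall n, (n >= N)%nat ->
        sqrt (inner (hadd (u n) (hopp l)) (hadd (u n) (hopp l))) < eps
}.
Arguments hzero {h}.
Arguments hadd {h}.
Arguments hopp {h}.
Arguments hscal {h}.
Arguments inner {h}.

Definition hsub {H : Hilbert} (x y : H) : H := hadd x (hopp y).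
Definition hnorm {H : Hilbert} (x : H) : R := sqrt (inner x x).

Fixpoint hsum {H : Hilbert} (n : nat) (F : nat -> H) : H :=
  match n with O => hzero | S n' => hadd (hsum n' F) (F n') end.
Fixpoint rsum (n : nat) (F : nat -> R) : R :=
  match n with O => 0 | S n' => rsum n' F + F n' end.

Definition strong_cv {H : Hilbert} (u : nat -> H) (l : H) : Prop :=
  forall eps, 0 < eps -> exists N, forall n, (n >= N)%nat -> hnorm (hsub (u n) l) < eps.
Definition weak_cv {H : Hilbert} (u : nat -> H) (l : H) : Prop :=
  forall z : H, Un_cv (fun n => inner (u n) z) (inner l z).

Definition bounded_linear {H G : Hilbert} (B : H -> G) : Prop :=
  (forall x y, B (hadd x y) = hadd (B x) (B y)) /\
  (forall a x, B (hscal a x) = hscal a (B x)) /\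
  (exists M, forall x, hnorm (B x) <= M * hnorm x).
Definition is_opnorm {H G : Hilbert} (B : H -> G) (nB : R) : Prop :=
  is_lub (fun r => exists x, hnorm x <= 1 /\ r = hnorm (B x)) nB.
Definition is_adjoint {H G : Hilbert} (B : H -> G) (Bs : G -> H) : Prop :=
  forall x y, inner (B x) y = inner x (Bs y).

Inductive ERbar := Fin (r : R) | PInf | MInf.
Definition Ele (a b : ERbar) : Prop :=
  match a, b with
  | MInf, _ => True
  | _, PInf => True
  | Fin x, Fin y => x <= y
  | _, _ => False
  end.
Definition Eaddr (r : R) (e : ERbar) : ERbar :=
  match e with Fin a => Fin (r + a) | PInf => PInf | MInf => MInf end.
(* extended + extended (+oo absorbing; only used on functions never -oo) *)
Definition Eplus (a b : ERbar) : ERbar :=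
  match a, b with
  | PInf, _ | _, PInf => PInf
  | MInf, _ | _, MInf => MInf
  | Fin x, Fin y => Fin (x + y)
  end.
Fixpoint Esum (n : nat) (F : nat -> ERbar) : ERbar :=
  match n with O => Fin 0 | S n' => Eplus (Esum n' F) (F n') end.
(* positive scalar times extended *)
Definition Escal (c : R) (e : ERbar) : ERbar :=
  match e with Fin a => Fin (c * a) | PInf => PInf | MInf => MInf end.

Definition Esup (E : R -> Prop) : ERbar :=
  match excluded_middle_informative (exists x, E x) with
  | right _ => MInf
  | left ne =>
      match excluded_middle_informative (bound E) with
      | left b => Fin (proj1_sig (completeness E b ne))
      | right _ => PInf
      end
  end.

Definition proper {H : Hilbert} (phi : H -> ERbar) : Prop :=
  (exists x, phi x <> PInf) /\ (forall x, phi x <> MInf).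
Definition convex_fun {H : Hilbert} (phi : H -> ERbar) : Prop :=
  forall x y a b t, 0 < t < 1 -> Ele (phi x) (Fin a) -> Ele (phi y) (Fin b) ->
    Ele (phi (hadd (hscal t x) (hscal (1 - t) y))) (Fin (t * a + (1 - t) * b)).
Definition lsc {H : Hilbert} (phi : H -> ERbar) : Prop :=
  forall (c : R) (u : nat -> H) (l : H),
    (forall n, Ele (phi (u n)) (Fin c)) -> strong_cv u l -> Ele (phi l) (Fin c).
Definition Gamma0 {H : Hilbert} (phi : H -> ERbar) : Prop :=
  proper phi /\ convex_fun phi /\ lsc phi.

Definition fconj {H : Hilbert} (phi : H -> ERbar) (y : H) : ERbar :=
  Esup (fun t => exists x a, phi x = Fin a /\ t = inner x y - a).

Definition is_prox {H : Hilbert} (lam : R) (phi : H -> ERbar) (u p : H) : Prop :=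
  forall z,
    Ele (Eaddr (/2 * inner (hsub p u) (hsub p u)) (Escal lam (phi p)))
        (Eaddr (/2 * inner (hsub z u) (hsub z u)) (Escal lam (phi z))).

Definition subdiff {H : Hilbert} (phi : H -> ERbar) (x v : H) : Prop :=
  exists a, phi x = Fin a /\ forall z, Ele (Fin (a + inner v (hsub z x))) (phi z).

Definition convex_real {H : Hilbert} (f : H -> R) : Prop :=
  forall x y t, 0 <= t <= 1 ->
    f (hadd (hscal t x) (hscal (1 - t) y)) <= t * f x + (1 - t) * f y.
Definition is_gradient {H : Hilbert} (f : H -> R) (gf : H -> H) : Prop :=
  forall x eps, 0 < eps -> exists delta, 0 < delta /\
    forall d, hnorm d < delta ->
      Rabs (f (hadd x d) - f x - inner (gf x) d) <= eps * hnorm d.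
Definition lipschitz {H : Hilbert} (F : H -> H) (L : R) : Prop :=
  forall x y, hnorm (hsub (F x) (F y)) <= L * hnorm (hsub x y).

(* Main.v *)
(** In rescaled dual variables [z], proportional to the [w_i y_i], one step is a
   proximal primal-dual step for a single operator [K] with [|K|^2 < 1]: Moreau's
   decomposition turns the proximal step for the conjugates into an inclusion of [z]
   in the subdifferential of the [h_i]. Cocoercivity of the gradient and cyclic
   monotonicity of the subdifferential of [g] make [|x - xs|^2 + |z - zs|^2] decrease
   along the iteration for every primal-dual solution [(xs, zs)], with summable
   residuals.

   Weak compactness is avoided: nested bounded convex sets always have a common
   adherent point, so the closed convex hulls of the tails of the iterates intersect.
   The saddle-point inequality is convex in the iterates, hence survives convex
   combinations and strong limits, and every point of the intersection is a
   primal-dual solution. Fejer monotonicity then forces the intersection to be a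
   single point, which is the weak limit. *)

Require Import Defs.
From Stdlib Require Import Reals Lra Lia ClassicalEpsilon.
Open Scope R_scope.

(** * Inner product calculus *)

(** Multipliers are kept multiplied by the primal step size, so an inclusion reads [s] in [tau]
    times the subdifferential. With the scaling factors [s i = sqrt (w i * lam)] no separate dual
    step size remains, and the condition on [lam] becomes the bound |K|^2 < 1. The obstacle in the
    limit is twofold. One step evaluates f, g and h at three different points, and <z, K x> is not
    jointly convex in (x, z). For a fixed competitor (u, q) the bilinear parts of the inequalities
    for g and h cancel through the adjoint, up to a vanishing residual; only <z, q - K u> remains,
    which is linear in z. The three arguments become separate coordinates of a product space, on
    which f + g + h is convex and lower semicontinuous, and the residuals close the gaps between
    them. The gradient is never followed to the limit along the iterates: the tangent inequality
    replaces it by values of f, and the descent lemma recovers it at the limit point. *)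

Lemma inner_addr {H : Hilbert} (x y z : H) :
  inner x (hadd y z) = inner x y + inner x z.
Proof. rewrite inner_sym, inner_add, (inner_sym _ y), (inner_sym _ z). reflexivity. Qed.

Lemma inner_scalr {H : Hilbert} (a : R) (x y : H) :
  inner x (hscal a y) = a * inner x y.
Proof. rewrite inner_sym, inner_scal, (inner_sym _ y). reflexivity. Qed.

Lemma inner_0l {H : Hilbert} (x : H) : inner hzero x = 0.
Proof.
  pose proof (inner_add _ (hzero : H) hzero x) as E.
  rewrite hadd_zero in E. lra.
Qed.

Lemma inner_0r {H : Hilbert} (x : H) : inner x hzero = 0.
Proof. rewrite inner_sym. apply inner_0l. Qed.

Lemma inner_oppl {H : Hilbert} (x y : H) : inner (hopp x) y = - inner x y.
Proof.
  pose proof (inner_add _ x (hopp x) y) as E.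
  rewrite hadd_opp, inner_0l in E. lra.
Qed.

Lemma inner_oppr {H : Hilbert} (x y : H) : inner x (hopp y) = - inner x y.
Proof. rewrite inner_sym, inner_oppl, inner_sym. reflexivity. Qed.

Ltac expand :=
  unfold hsub in *;
  repeat (rewrite inner_add in * || rewrite inner_addr in *
          || rewrite inner_scal in * || rewrite inner_scalr in *
          || rewrite inner_oppl in * || rewrite inner_oppr in *
          || rewrite inner_0l in * || rewrite inner_0r in *).

(* Once [expand] has reduced everything to inner products of atoms, orienting
   each symmetric pair lets [lra] and [ring] see them as the same monomial. *)
Ltac orient :=
  repeat match goal with
  | |- context [@inner ?H ?a ?b] =>
      match goal with
      | |- context [@inner H b a] =>
          first [constr_eq a b; fail 1 | rewrite (inner_sym H b a)]
      end
  end.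

Ltac inner_goal := expand; orient.

Lemma inner_ext {H : Hilbert} (x y : H) : (forall z, inner x z = inner y z) -> x = y.
Proof.
  intros E.
  assert (D : hadd x (hopp y) = hzero).
  { apply inner_def. rewrite inner_add, inner_oppl, E. ring. }
  rewrite <- (hadd_zero _ x), <- (hadd_opp _ y), (hadd_comm _ y), hadd_assoc, D,
    hadd_comm, hadd_zero.
  reflexivity.
Qed.

(** A vector identity tested against an arbitrary [z] becomes an identity between real numbers,
    which [ring] and [field] can settle. *)
Ltac vec := apply inner_ext; let z := fresh "z" in intro z; expand; try ring; try field.

Lemma sub_eq0 {H : Hilbert} (x y : H) : inner (hsub x y) (hsub x y) <= 0 -> x = y.
Proof.
  intros E. assert (D : hsub x y = hzero).
  { apply inner_def. pose proof (inner_pos _ (hsub x y)). lra. }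
  apply inner_ext. intro z.
  assert (E1 : inner (hsub x y) z = 0) by (rewrite D; apply inner_0l).
  expand. lra.
Qed.

Lemma hnorm_ge0 {H : Hilbert} (x : H) : 0 <= hnorm x.
Proof. apply sqrt_pos. Qed.

Lemma hnorm_sq {H : Hilbert} (x : H) : hnorm x * hnorm x = inner x x.
Proof. apply sqrt_sqrt, inner_pos. Qed.

Lemma hnorm_le_sq {H : Hilbert} (x : H) (r : R) :
  0 <= r -> inner x x <= r * r -> hnorm x <= r.
Proof.
  intros Hr E. unfold hnorm. rewrite <- (sqrt_square r Hr). now apply sqrt_le_1_alt.
Qed.

Lemma cauchy_schwarz {H : Hilbert} (x y : H) : Rabs (inner x y) <= hnorm x * hnorm y.
Proof.
  assert (Q : inner x y * inner x y <= inner x x * inner y y).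
  { pose proof (inner_pos _ x) as Px. pose proof (inner_pos _ y) as Py.
    destruct (Req_dec (inner y y) 0) as [Z|Z].
    - apply inner_def in Z. subst y. rewrite !inner_0r. lra.
    (* This is the component of x orthogonal to y, multiplied by |y|^2 to avoid a division; its
       square is |y|^2 (|x|^2 |y|^2 - <x,y>^2). *)
    - pose proof (inner_pos _ (hsub (hscal (inner y y) x) (hscal (inner x y) y))) as P.
      revert P. inner_goal. intros P.
      assert (0 < inner y y) by lra.
      apply Rmult_le_reg_l with (inner y y); [lra|].
      nra. }
  rewrite <- (Rabs_pos_eq (hnorm x * hnorm y)).
  - apply Rsqr_le_abs_0. unfold Rsqr.
    pose proof (hnorm_sq x). pose proof (hnorm_sq y).
    replace (hnorm x * hnorm y * (hnorm x * hnorm y))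
      with ((hnorm x * hnorm x) * (hnorm y * hnorm y)) by ring.
    rewrite H0, H1; exact Q.
  - apply Rmult_le_pos; apply hnorm_ge0.
Qed.

Lemma inner_le_norms {H : Hilbert} (x y : H) : inner x y <= hnorm x * hnorm y.
Proof. eapply Rle_trans; [apply Rle_abs | apply cauchy_schwarz]. Qed.

Lemma inner_ge_norms {H : Hilbert} (x y : H) : - (hnorm x * hnorm y) <= inner x y.
Proof. pose proof (cauchy_schwarz x y) as E. 
  unfold Rabs in E. destruct (Rcase_abs (inner x y)); lra. Qed.

Lemma hnorm_triangle {H : Hilbert} (x y : H) : hnorm (hadd x y) <= hnorm x + hnorm y.
Proof.
  pose proof (hnorm_ge0 x). pose proof (hnorm_ge0 y).
  apply hnorm_le_sq; [lra|].
  pose proof (inner_le_norms x y) as C.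
  pose proof (hnorm_sq x). pose proof (hnorm_sq y).
  inner_goal. nra.
Qed.

Lemma hnorm_scal {H : Hilbert} (a : R) (x : H) : hnorm (hscal a x) = Rabs a * hnorm x.
Proof.
  unfold hnorm. rewrite inner_scal, inner_scalr, <- Rmult_assoc.
  rewrite sqrt_mult_alt by apply Rle_0_sqr.
  f_equal. apply sqrt_Rsqr_abs.
Qed.

Lemma hnorm_sub_sym {H : Hilbert} (x y : H) : hnorm (hsub x y) = hnorm (hsub y x).
Proof. unfold hnorm. f_equal. inner_goal. ring. Qed.

Lemma hnorm_sub_triangle {H : Hilbert} (x y z : H) :
  hnorm (hsub x z) <= hnorm (hsub x y) + hnorm (hsub y z).
Proof.
  replace (hsub x z) with (hadd (hsub x y) (hsub y z)) by vec.
  apply hnorm_triangle.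
Qed.

Lemma young_inner {H : Hilbert} (s : R) (x y : H) :
  0 < s -> 0 <= 2 * inner x y + s * inner x x + / s * inner y y.
Proof.
  intros Hs.
  pose proof (inner_pos _ (hadd (hscal s x) y)) as P. revert P.
  inner_goal. intros P.
  apply Rmult_le_reg_l with s; [lra|].
  replace (s * (2 * inner x y + s * inner x x + / s * inner y y))
    with (2 * s * inner x y + s * s * inner x x + inner y y) by (field; lra).
  lra.
Qed.

Lemma choice {A B : Type} (P : A -> B -> Prop) :
  (forall a, exists b, P a b) -> exists F : A -> B, forall a, P a (F a).
Proof.
  intros E. exists (fun a => proj1_sig (constructive_indefinite_description _ (E a))).
  intro a. exact (proj2_sig (constructive_indefinite_description _ (E a))).
Qed.

(** Stands in for letting t tend to 0. If A > 0, then t = 1/2 forces B > 0, and t = A / (2 B) gives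
    A <= A / 2. *)
Lemma le_of_small (A B : R) : (forall t, 0 < t < 1 -> A <= t * B) -> A <= 0.
Proof.
  intros E. apply Rnot_lt_le. intro P.
  pose proof (E (/2) ltac:(lra)) as E1.
  assert (PB : 0 < B) by lra.
  assert (Q : 0 < A / (2 * B)) by (apply Rdiv_lt_0_compat; lra).
  assert (Q2 : A / (2 * B) < 1).
  { apply Rmult_lt_reg_r with (2 * B); [lra|]. unfold Rdiv.
    rewrite Rmult_assoc, Rinv_l by lra. lra. }
  pose proof (E (A / (2 * B)) (conj Q Q2)) as E2.
  replace (A / (2 * B) * B) with (A / 2) in E2 by (field; lra). lra.
Qed.

Lemma infimum_exists (S : R -> Prop) (b : R) :
  (exists r, S r) -> (forall r, S r -> b <= r) ->
  exists i, (forall r, S r -> i <= r) /\ forall eps, 0 < eps -> exists r, S r /\ r < i + eps.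
Proof.
  intros [r0 Hr0] Hb.
  destruct (completeness (fun r => S (- r))) as [s [Hub Hlub]].
  - exists (- b). intros r Hr. apply Hb in Hr. lra.
  - exists (- r0). now rewrite Ropp_involutive.
  - exists (- s). split.
    + intros r Hr. assert (- r <= s) by (apply Hub; now rewrite Ropp_involutive). lra.
    + intros eps He. apply NNPP. intro N.
      assert (s <= s - eps); [|lra].
      apply Hlub. intros r Hr. apply Rnot_lt_le. intro L.
      apply N. exists (- r). split; [exact Hr | lra].
Qed.

(** * Nested convex sets *)

Definition convex_set {E : Hilbert} (Q : E -> Prop) : Prop :=
  forall x y t, 0 < t < 1 -> Q x -> Q y -> Q (hadd (hscal t x) (hscal (1 - t) y)).

Definition adherent {E : Hilbert} (Q : E -> Prop) (c : E) : Prop :=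
  forall d, 0 < d -> exists a, Q a /\ hnorm (hsub a c) < d.

Lemma nat_inv_small (eps : R) : 0 < eps ->
  exists N, forall n, (n >= N)%nat -> / (INR n + 1) < eps.
Proof.
  intros He. destruct (archimed_cor1 eps He) as [N [HN HN0]].
  exists N. intros n Hn. eapply Rlt_trans; [|exact HN].
  apply Rinv_lt_contravar.
  - apply Rmult_lt_0_compat; [apply lt_0_INR; lia|]. pose proof (pos_INR n). lra.
  - apply le_INR in Hn. lra.
Qed.

(* The almost-minimal-norm elements of the [A n] form a Cauchy sequence, by the
   parallelogram identity; its limit replaces weak compactness of balls. *)
Lemma nested_convex_adherent {E : Hilbert} (A : nat -> E -> Prop) (M : R) :
  (forall n, convex_set (A n)) ->
  (forall n, exists x, A n x) ->
  (forall n p x, (n <= p)%nat -> A p x -> A n x) ->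
  (forall x, A O x -> inner x x <= M) ->
  exists c, forall n, adherent (A n) c.
Proof.
  intros Hc Hne Hdec HM.
  assert (Hi : forall n, exists i,
    (forall x, A n x -> i <= inner x x) /\
    forall eps, 0 < eps -> exists x, A n x /\ inner x x < i + eps).
  { intro n. destruct (infimum_exists (fun r => exists x, A n x /\ r = inner x x) 0)
      as [i [H1 H2]].
    - destruct (Hne n) as [x Hx]. exists (inner x x), x. auto.
    - intros r [x [_ ->]]. apply inner_pos.
    - exists i. split.
      + intros x Hx. apply H1. exists x. auto.
      + intros eps He. destruct (H2 eps He) as [r [[x [Hx ->]] Hr]]. exists x. auto. }
  apply choice in Hi. destruct Hi as [d Hd].
  assert (dinc : forall n p, (n <= p)%nat -> d n <= d p).
  { intros n p Hnp. apply Rnot_lt_le. intro L.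
    destruct (Hd p) as [_ H2]. destruct (H2 (d n - d p)) as [x [Hx Hlt]]; [lra|].
    destruct (Hd n) as [H1 _]. specialize (H1 x (Hdec _ _ _ Hnp Hx)). lra. }
  assert (dcv : exists l, Un_cv d l).
  { destruct (growing_cv d) as [l Hl].
    - intro n. apply dinc. lia.
    - exists M. intros r [n ->]. destruct (Hne n) as [x Hx].
      apply Rle_trans with (inner x x); [now apply Hd|].
      apply HM, (Hdec O n); [lia | exact Hx].
    - now exists l. }
  assert (Ha : forall n, exists x, A n x /\ inner x x < d n + / (INR n + 1)).
  { intro n. apply Hd. apply Rinv_0_lt_compat. pose proof (pos_INR n). lra. }
  apply choice in Ha. destruct Ha as [a Ha].
  assert (step : forall n p, (n <= p)%nat ->
    inner (hsub (a n) (a p)) (hsub (a n) (a p))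
      <= 2 * (d p - d n) + 2 * / (INR n + 1) + 2 * / (INR p + 1)).
  { intros n p Hnp.
    destruct (Ha n) as [An Ln]. destruct (Ha p) as [Ap Lp].
    assert (Mid : A n (hadd (hscal (/2) (a n)) (hscal (1 - /2) (a p)))).
    { apply Hc; [lra | exact An | exact (Hdec _ _ _ Hnp Ap)]. }
    apply Hd in Mid. revert Mid. inner_goal. intros Mid. lra. }
  destruct dcv as [l Hl].
  destruct (complete E a) as [c Hcv].
  { intros eps He.
    (* The three terms of [step] stay below e2, 2 e2 and 2 e2, a total of 5 e2 < eps^2. *)
    set (e2 := eps * eps / 8). assert (He2 : 0 < e2) by (unfold e2; nra).
    destruct (nat_inv_small e2 He2) as [N1 HN1].
    destruct (Hl (e2 / 4)) as [N2 HN2]; [lra|].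
    assert (le_case : forall n p, (n >= N1 + N2)%nat -> (n <= p)%nat ->
      sqrt (inner (hadd (a n) (hopp (a p))) (hadd (a n) (hopp (a p)))) < eps).
    { intros n p Hn Hnp. change (hadd (a n) (hopp (a p))) with (hsub (a n) (a p)).
      rewrite <- (sqrt_square eps) by lra. apply sqrt_lt_1_alt.
      split; [apply inner_pos|].
      pose proof (step n p Hnp). pose proof (HN1 n ltac:(lia)).
      pose proof (HN1 p ltac:(lia)).
      pose proof (HN2 n ltac:(lia)) as D1. pose proof (HN2 p ltac:(lia)) as D2.
      unfold Rdist in *. apply Rabs_def2 in D1. apply Rabs_def2 in D2.
      unfold e2 in *. lra. }
    exists (N1 + N2)%nat. intros n p Hn Hp.
    destruct (Nat.le_ge_cases n p) as [L|L].
    - now apply le_case.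
    - pose proof (le_case p n Hp L) as Q.
      change (hnorm (hsub (a p) (a n)) < eps) in Q.
      change (hnorm (hsub (a n) (a p)) < eps). now rewrite hnorm_sub_sym. }
  exists c. intros n e He. destruct (Hcv e He) as [N HN].
  exists (a (n + N)%nat). split.
  - apply (Hdec n (n + N)%nat); [lia | apply Ha].
  - apply HN. lia.
Qed.

(** Defined as the intersection of all convex supersets: a property passes from [P] to its hull as
    soon as it is convex, without writing finite combinations. *)
Definition hull {E : Hilbert} (P : E -> Prop) (a : E) : Prop :=
  forall Q : E -> Prop, convex_set Q -> (forall x, P x -> Q x) -> Q a.

Lemma hull_convex {E : Hilbert} (P : E -> Prop) : convex_set (hull P).
Proof. intros x y t Ht Hx Hy Q HQ HP. apply HQ; [exact Ht | apply Hx | apply Hy]; auto. Qed.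

Lemma hull_base {E : Hilbert} (P : E -> Prop) (x : E) : P x -> hull P x.
Proof. intros Hx Q _ HP. auto. Qed.

Lemma hull_mono {E : Hilbert} (P P' : E -> Prop) (x : E) :
  (forall y, P y -> P' y) -> hull P x -> hull P' x.
Proof. intros HPP Hx Q HQ HP. apply Hx; auto. Qed.

Lemma ball_convex {E : Hilbert} (s : E) (r : R) :
  convex_set (fun a => inner (hsub a s) (hsub a s) <= r).
Proof.
  intros x y t Ht Hx Hy.
  pose proof (inner_pos _ (hsub x y)) as P.
  assert (inner (hsub (hadd (hscal t x) (hscal (1 - t) y)) s)
                (hsub (hadd (hscal t x) (hscal (1 - t) y)) s)
    = t * inner (hsub x s) (hsub x s) + (1 - t) * inner (hsub y s) (hsub y s)
      - t * (1 - t) * inner (hsub x y) (hsub x y)) as -> by (inner_goal; ring).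
  assert (0 <= t * (1 - t) * inner (hsub x y) (hsub x y)).
  { apply Rmult_le_pos; [nra | exact P]. }
  nra.
Qed.

Lemma halfspace_convex {E : Hilbert} (z : E) (r : R) :
  convex_set (fun a => inner a z <= r).
Proof. intros x y t Ht Hx Hy. expand. nra. Qed.

(** * Fejer monotone sequences *)

Definition tail {E : Hilbert} (X : nat -> E) (N : nat) (a : E) : Prop :=
  exists k, (k >= N)%nat /\ a = X k.

(** The intersection of the closed convex hulls of the tails, the substitute for the set of weak
    cluster points. *)
Definition tail_adherent {E : Hilbert} (X : nat -> E) (c : E) : Prop :=
  forall N, adherent (hull (tail X N)) c.

Lemma adherent_inner_le {E : Hilbert} (P : E -> Prop) (z c : E) (r : R) :
  (forall a, P a -> inner a z <= r) -> adherent (hull P) c -> inner c z <= r.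
Proof.
  intros HP Hc.
  assert (inner c z - r <= 0); [|lra].
  apply le_of_small with (hnorm z). intros t Ht.
  destruct (Hc t) as [a [Ha Hd]]; [lra|].
  assert (inner a z <= r) by (apply Ha; [apply halfspace_convex | exact HP]).
  pose proof (inner_ge_norms (hsub a c) z) as C. pose proof (hnorm_ge0 z).
  assert (hnorm (hsub a c) * hnorm z <= t * hnorm z) by nra.
  expand. lra.
Qed.

(** Opial's argument. For two tail-adherent points c and c', convergence of both distances makes <X
    n, c' - c> converge; half-spaces pass to closed hulls, so c and c' have the same inner product
    with c' - c and coincide. *)
Lemma fejer_weak_cv {E : Hilbert} (X : nat -> E) (S : E -> Prop) :
  (exists s, S s) ->
  (forall s k, S s -> inner (hsub (X (Datatypes.S k)) s) (hsub (X (Datatypes.S k)) s)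
                      <= inner (hsub (X k) s) (hsub (X k) s)) ->
  (forall c, tail_adherent X c -> S c) ->
  exists c, S c /\ weak_cv X c.
Proof.
  intros [s0 Hs0] Hfej Hcl.
  assert (Hcv : forall s, S s -> exists l,
    Un_cv (fun n => inner (hsub (X n) s) (hsub (X n) s)) l).
  { intros s Hs.
    destruct (decreasing_cv (fun n => inner (hsub (X n) s) (hsub (X n) s))) as [l Hl].
    - intro n. now apply Hfej.
    - exists 0. intros r [n ->]. unfold opp_seq.
      pose proof (inner_pos _ (hsub (X n) s)). lra.
    - now exists l. }
  set (M0 := inner (hsub (X O) s0) (hsub (X O) s0)).
  assert (Hb : forall n, inner (hsub (X n) s0) (hsub (X n) s0) <= M0).
  { induction n; [unfold M0; lra|]. eapply Rle_trans; [apply Hfej, Hs0 | exact IHn]. }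
  (* Stated for decreasing subfamilies of the tails, since it is also applied to the iterates that
     would violate weak convergence. *)
  assert (Hnest : forall P : nat -> E -> Prop,
    (forall n, exists x, P n x) ->
    (forall n p x, (n <= p)%nat -> P p x -> P n x) ->
    (forall n x, P n x -> tail X n x) ->
    exists c, tail_adherent X c /\ forall n, adherent (hull (P n)) c).
  { intros P Pne Pdec Pt.
    destruct (nested_convex_adherent (fun n => hull (P n)) (2 * M0 + 2 * inner s0 s0))
      as [c Hc].
    - intro n. apply hull_convex.
    - intro n. destruct (Pne n) as [x Hx]. exists x. now apply hull_base.
    - intros n p x Hnp. apply hull_mono. intros y. now apply Pdec.
    - intros x Hx.
      assert (B : inner (hsub x s0) (hsub x s0) <= M0).
      { apply Hx; [apply ball_convex|]. intros y Hy.
        apply Pt in Hy. destruct Hy as [k [_ ->]]. apply Hb. }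
      (* |x - 2 s0|^2 >= 0 is the inequality |x|^2 <= 2 |x - s0|^2 + 2 |s0|^2. *)
      pose proof (inner_pos _ (hsub x (hscal 2 s0))) as Q.
      revert B Q. inner_goal. intros B Q. lra.
    - exists c. split; [|exact Hc]. intros N d Hd.
      destruct (Hc N d Hd) as [a [Ha Hac]]. exists a. split; [|exact Hac].
      revert Ha. apply hull_mono, Pt. }
  assert (tail_ne : forall n, exists x, tail X n x).
  { intro n. exists (X n), n. auto. }
  assert (tail_dec : forall n p x, (n <= p)%nat -> tail X p x -> tail X n x).
  { intros n p x Hnp [k [Hk ->]]. exists k. split; [lia | reflexivity]. }
  destruct (Hnest (tail X) tail_ne tail_dec (fun n x Hx => Hx)) as [c [Hc _]].
  assert (Sc : S c) by now apply Hcl.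
  assert (uniq : forall c', tail_adherent X c' -> c' = c).
  { intros c' Hc'.
    assert (Sc' : S c') by now apply Hcl.
    destruct (Hcv c Sc) as [l Hl]. destruct (Hcv c' Sc') as [l' Hl'].
    set (e := hsub c' c).
    (* [<X n, e>] converges because it is an affine function of the two distances *)
    set (ell := (l - l' - inner c c + inner c' c') / 2).
    assert (Hell : forall eps, 0 < eps -> exists N, forall n, (n >= N)%nat ->
              Rabs (inner (X n) e - ell) < eps).
    { intros eps He. destruct (Hl eps He) as [N1 H1]. destruct (Hl' eps He) as [N2 H2].
      exists (N1 + N2)%nat. intros n Hn.
      specialize (H1 n ltac:(lia)). specialize (H2 n ltac:(lia)).
      unfold Rdist in *. apply Rabs_def2 in H1. apply Rabs_def2 in H2.
      unfold e, ell. revert H1 H2. inner_goal. intros H1 H2.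
      apply Rabs_def1; lra. }
    assert (Had : forall b, tail_adherent X b -> inner b e = ell).
    { intros b Hbd. apply Rle_antisym; apply Rnot_lt_le; intro L.
      - destruct (Hell ((inner b e - ell) / 2)) as [N HN]; [lra|].
        assert (inner b e <= ell + (inner b e - ell) / 2); [|lra].
        apply adherent_inner_le with (tail X N); [|apply Hbd].
        intros a [k [Hk ->]]. specialize (HN k Hk).
        apply Rabs_def2 in HN. lra.
      - destruct (Hell ((ell - inner b e) / 2)) as [N HN]; [lra|].
        assert (inner b (hopp e) <= - (ell - (ell - inner b e) / 2)).
        { apply adherent_inner_le with (tail X N); [|apply Hbd].
          intros a [k [Hk ->]]. specialize (HN k Hk).
          apply Rabs_def2 in HN. rewrite inner_oppr. lra. }
        rewrite inner_oppr in *. lra. }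
    pose proof (Had c Hc) as E1. pose proof (Had c' Hc') as E2.
    apply sub_eq0. unfold e in *. revert E1 E2. inner_goal. intros E1 E2. lra. }
  exists c. split; [exact Sc|].
  (* If this failed, the offending iterates would have an adherent point of their hulls. By
     uniqueness it is c, yet it satisfies <c, z> >= <c, z> + eps. The lower bound follows by using
     [hopp z]. *)
  assert (upper : forall z eps, 0 < eps -> exists N, forall n, (n >= N)%nat ->
            inner (X n) z < inner c z + eps).
  { intros z eps He. apply NNPP. intro Nn.
    destruct (Hnest (fun n a => tail X n a /\ inner c z + eps <= inner a z))
      as [c' [Hc' Hz]].
    - intro n. apply NNPP. intro Q. apply Nn. exists n. intros k Hk.
      apply Rnot_le_lt. intro L. apply Q. exists (X k). split; [|exact L].
      now exists k.
    - intros n p x Hnp [Ht Hx]. split; [|exact Hx]. now apply tail_dec with p.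
    - now intros n x [Ht _].
    - apply uniq in Hc'. subst c'.
      assert (inner c (hopp z) <= - (inner c z + eps)).
      { apply adherent_inner_le with (2 := Hz O). intros a [_ Ha].
        rewrite inner_oppr. lra. }
      rewrite inner_oppr in *. lra. }
  intros z eps He.
  destruct (upper z eps He) as [N1 H1]. destruct (upper (hopp z) eps He) as [N2 H2].
  exists (N1 + N2)%nat. intros n Hn.
  specialize (H1 n ltac:(lia)). specialize (H2 n ltac:(lia)).
  rewrite !inner_oppr in H2. apply Rabs_def1; lra.
Qed.

(** * Lower semicontinuity and product spaces *)

Lemma lsc_adherent {H : Hilbert} (phi : H -> ERbar) (l : H) (r : R) :
  lsc phi -> adherent (fun a => Ele (phi a) (Fin r)) l -> Ele (phi l) (Fin r).
Proof.
  intros Hl Had.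
  assert (C : forall n : nat, exists a, Ele (phi a) (Fin r) /\ hnorm (hsub a l) < / (INR n + 1)).
  { intro n. apply Had. apply Rinv_0_lt_compat. pose proof (pos_INR n). lra. }
  apply choice in C. destruct C as [u Hu].
  apply Hl with u.
  - intro n. apply Hu.
  - intros eps He. destruct (nat_inv_small eps He) as [N HN]. exists N. intros n Hn.
    eapply Rlt_trans; [apply Hu | now apply HN].
Qed.

(** The neighbourhood form lets two functions be controlled at one common index of a sequence, as a
    sum requires. *)
Lemma lsc_neighbourhood {H : Hilbert} (phi : H -> ERbar) (l : H) (r : R) :
  lsc phi -> ~ Ele (phi l) (Fin r) ->
  exists d, 0 < d /\ forall a, hnorm (hsub a l) < d -> ~ Ele (phi a) (Fin r).
Proof.
  intros Hl Hn. apply NNPP. intro N. apply Hn, lsc_adherent; [exact Hl|].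
  intros d Hd. apply NNPP. intro N'. apply N. exists d. split; [exact Hd|].
  intros a Ha E. apply N'. now exists a.
Qed.

Lemma Ele_eps (e : ERbar) (r : R) :
  (forall eps, 0 < eps -> Ele e (Fin (r + eps))) -> Ele e (Fin r).
Proof.
  intros E. destruct e as [a| |]; simpl in *.
  - apply Rnot_lt_le. intro L. specialize (E ((a - r) / 2) ltac:(lra)). lra.
  - now apply (E 1); lra.
  - exact I.
Qed.

Lemma Ele_trans_fin (e : ERbar) (r s : R) : Ele e (Fin r) -> r <= s -> Ele e (Fin s).
Proof. destruct e; simpl; auto. intros; lra. Qed.

Lemma sqrt_add_lt (a b eps : R) :
  0 <= a -> 0 <= b -> 0 < eps -> sqrt a < eps / 2 -> sqrt b < eps / 2 -> sqrt (a + b) < eps.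
Proof.
  intros Ha Hb He Sa Sb. rewrite <- (sqrt_square eps) by lra. apply sqrt_lt_1_alt.
  pose proof (sqrt_pos a). pose proof (sqrt_pos b).
  pose proof (sqrt_sqrt a Ha). pose proof (sqrt_sqrt b Hb). nra.
Qed.

(** Closed transparently, so that inner products and operations on pairs reduce to those of the
    components. *)
Definition prodH (H G : Hilbert) : Hilbert.
Proof.
  refine (@MkHilbert (H * G) (hzero, hzero)
    (fun p q => (hadd (fst p) (fst q), hadd (snd p) (snd q)))
    (fun p => (hopp (fst p), hopp (snd p)))
    (fun a p => (hscal a (fst p), hscal a (snd p)))
    (fun p q => inner (fst p) (fst q) + inner (snd p) (snd q))
    _ _ _ _ _ _ _ _ _ _ _ _ _ _); simpl.
  - intros x y z. f_equal; apply hadd_assoc.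
  - intros x y. f_equal; apply hadd_comm.
  - intros [x1 x2]. simpl. f_equal; apply hadd_zero.
  - intros x. f_equal; apply hadd_opp.
  - intros [x1 x2]. simpl. f_equal; apply hscal_one.
  - intros a b x. f_equal; apply hscal_assoc.
  - intros a x y. f_equal; apply hscal_distr_l.
  - intros a b x. f_equal; apply hscal_distr_r.
  - intros x y. f_equal; apply inner_sym.
  - intros x y z. rewrite !inner_add. ring.
  - intros a x y. rewrite !inner_scal. ring.
  - intros x. pose proof (inner_pos _ (fst x)). pose proof (inner_pos _ (snd x)). lra.
  - intros [x1 x2] E. simpl in E. pose proof (inner_pos _ x1). pose proof (inner_pos _ x2).
    f_equal; apply inner_def; lra.
  - intros u Hu.
    destruct (complete H (fun n => fst (u n))) as [l1 H1].
    { intros eps He. destruct (Hu eps He) as [N HN]. exists N. intros n p Hn Hp.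
      eapply Rle_lt_trans; [|exact (HN n p Hn Hp)]. apply sqrt_le_1_alt.
      match goal with |- _ <= _ + inner ?a ?b => pose proof (inner_pos _ a) end. lra. }
    destruct (complete G (fun n => snd (u n))) as [l2 H2].
    { intros eps He. destruct (Hu eps He) as [N HN]. exists N. intros n p Hn Hp.
      eapply Rle_lt_trans; [|exact (HN n p Hn Hp)]. apply sqrt_le_1_alt.
      match goal with |- _ <= inner ?a ?b + _ => pose proof (inner_pos _ a) end. lra. }
    exists (l1, l2). intros eps He.
    destruct (H1 (eps / 2)) as [N1 HN1]; [lra|].
    destruct (H2 (eps / 2)) as [N2 HN2]; [lra|].
    exists (N1 + N2)%nat. intros n Hn. simpl.
    apply sqrt_add_lt; try apply inner_pos; try exact He;
      [apply HN1 | apply HN2]; lia.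
Defined.

Definition unitH : Hilbert.
Proof.
  refine (@MkHilbert unit tt (fun _ _ => tt) (fun _ => tt) (fun _ _ => tt) (fun _ _ => 0)
    _ _ _ _ _ _ _ _ _ _ _ _ _ _); intros; try ring; try lra;
    try (now repeat match goal with x : unit |- _ => destruct x end).
  exists tt. intros eps He. exists O. intros n _. now rewrite sqrt_0.
Defined.

Lemma hnorm_fst_le {H G : Hilbert} (p : prodH H G) : hnorm (fst p) <= hnorm p.
Proof.
  apply sqrt_le_1_alt. simpl. pose proof (inner_pos _ (snd p)). lra.
Qed.

Lemma hnorm_snd_le {H G : Hilbert} (p : prodH H G) : hnorm (snd p) <= hnorm p.
Proof.
  apply sqrt_le_1_alt. simpl. pose proof (inner_pos _ (fst p)). lra.
Qed.

Lemma hnorm_pair_lt {H G : Hilbert} (a : H) (b : G) (eps : R) : 0 < eps ->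
  hnorm a < eps / 2 -> hnorm b < eps / 2 -> hnorm ((a, b) : prodH H G) < eps.
Proof. intros He Ha Hb. apply sqrt_add_lt; try apply inner_pos; assumption. Qed.

Definition sum_fun {H G : Hilbert} (phi : H -> ERbar) (psi : G -> ERbar)
  (p : prodH H G) : ERbar := Eplus (phi (fst p)) (psi (snd p)).

Lemma sum_fun_Gamma0 {H G : Hilbert} (phi : H -> ERbar) (psi : G -> ERbar) :
  Gamma0 phi -> Gamma0 psi -> Gamma0 (sum_fun phi psi).
Proof.
  intros [[[x0 Hx0] Pp] [Cp Lp]] [[[y0 Hy0] Pq] [Cq Lq]]. split; [split|split].
  - exists (x0, y0). unfold sum_fun. simpl.
    specialize (Pp x0). specialize (Pq y0).
    destruct (phi x0), (psi y0); simpl; congruence.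
  - intros [a b]. unfold sum_fun. simpl. specialize (Pp a). specialize (Pq b).
    destruct (phi a), (psi b); simpl; congruence.
  - intros [x1 x2] [y1 y2] a b t Ht. unfold sum_fun. simpl. intros Ha Hb.
    pose proof (Pp x1) as P1. pose proof (Pq x2) as P2.
    pose proof (Pp y1) as P3. pose proof (Pq y2) as P4.
    pose proof (Pp (hadd (hscal t x1) (hscal (1 - t) y1))) as P5.
    pose proof (Pq (hadd (hscal t x2) (hscal (1 - t) y2))) as P6.
    pose proof (Cp x1 y1) as C1. pose proof (Cq x2 y2) as C2.
    destruct (phi x1) as [a1| |]; try easy; destruct (psi x2) as [a2| |]; try easy.
    destruct (phi y1) as [b1| |]; try easy; destruct (psi y2) as [b2| |]; try easy.
    specialize (C1 a1 b1 t Ht (Rle_refl _) (Rle_refl _)).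
    specialize (C2 a2 b2 t Ht (Rle_refl _) (Rle_refl _)).
    simpl in *.
    destruct (phi (hadd (hscal t x1) (hscal (1 - t) y1))); try easy.
    destruct (psi (hadd (hscal t x2) (hscal (1 - t) y2))); try easy.
    simpl in *. nra.
  - intros c u [l1 l2] Hu Hcv. apply NNPP. intro N. unfold sum_fun in *. simpl in *.
    (* A value above [c] leaves room to split [c] strictly below both summands; each strict bound
       persists near its point, which contradicts the bound on the sum along [u]. *)
    assert (split_c : exists r1 r2, r1 + r2 = c /\
              ~ Ele (phi l1) (Fin r1) /\ ~ Ele (psi l2) (Fin r2)).
    { pose proof (Pp l1). pose proof (Pq l2).
      destruct (phi l1) as [A| |]; try easy; destruct (psi l2) as [B| |]; try easy; simpl in *.
      - exists (A - (A + B - c) / 2), (B - (A + B - c) / 2). repeat split; lra.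
      - exists (A - 1), (c - A + 1). repeat split; lra.
      - exists (c - B + 1), (B - 1). repeat split; lra.
      - exists c, 0. repeat split; auto; lra. }
    destruct split_c as [r1 [r2 [Hr [N1 N2]]]].
    apply lsc_neighbourhood in N1; [|exact Lp]. apply lsc_neighbourhood in N2; [|exact Lq].
    destruct N1 as [d1 [Hd1 N1]]. destruct N2 as [d2 [Hd2 N2]].
    destruct (Hcv (Rmin d1 d2)) as [n Hn]; [now apply Rmin_glb_lt|].
    specialize (Hn n (le_n n)). specialize (Hu n).
    specialize (N1 (fst (u n))). specialize (N2 (snd (u n))).
    pose proof (Rmin_l d1 d2). pose proof (Rmin_r d1 d2).
    pose proof (hnorm_fst_le (@hsub (prodH H G) (u n) (l1, l2))) as F1.
    pose proof (hnorm_snd_le (@hsub (prodH H G) (u n) (l1, l2))) as F2.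
    simpl in F1, F2.
    assert (M1 := N1 ltac:(unfold hsub in *; simpl in *; lra)).
    assert (M2 := N2 ltac:(unfold hsub in *; simpl in *; lra)).
    pose proof (Pp (fst (u n))). pose proof (Pq (snd (u n))).
    destruct (phi (fst (u n))); try easy; destruct (psi (snd (u n))); try easy.
    simpl in *. lra.
Qed.

(** * Smooth convex functions *)

(** Convexity on the segment bounds f (x + t d) - f x by t (f y - f x); the first-order expansion
    bounds it below by t <gf x, d> up to e t |d|. Divide by t and let e tend to 0. *)
Lemma gradient_ineq {H : Hilbert} (f : H -> R) (gf : H -> H) :
  convex_real f -> is_gradient f gf ->
  forall x y, f x + inner (gf x) (hsub y x) <= f y.
Proof.
  intros Hc Hg x y. set (d := hsub y x).
  assert (f x + inner (gf x) d - f y <= 0); [|lra].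
  apply le_of_small with (hnorm d). intros e He.
  destruct (Hg x e) as [delta [Hdelta HD]]; [lra|].
  pose proof (hnorm_ge0 d) as Nd.
  (* Keeps t below 1 for convexity and |t d| below delta; the added 1 covers d = 0. *)
  set (t := Rmin (/2) (delta / (2 * (hnorm d + 1)))).
  assert (Ht : 0 < t).
  { apply Rmin_glb_lt; [lra|]. apply Rdiv_lt_0_compat; lra. }
  assert (Ht1 : t <= /2) by apply Rmin_l.
  assert (Htd : t * hnorm d < delta).
  { apply Rle_lt_trans with (delta / (2 * (hnorm d + 1)) * hnorm d).
    - apply Rmult_le_compat_r; [exact Nd | apply Rmin_r].
    - apply Rmult_lt_reg_r with (2 * (hnorm d + 1)); [lra|].
      replace (delta / (2 * (hnorm d + 1)) * hnorm d * (2 * (hnorm d + 1)))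
        with (delta * hnorm d) by (field; lra). nra. }
  assert (Nt : hnorm (hscal t d) = t * hnorm d).
  { rewrite hnorm_scal, Rabs_pos_eq; lra. }
  specialize (HD (hscal t d)). rewrite Nt in HD. specialize (HD Htd).
  rewrite inner_scalr in HD.
  pose proof (Hc y x t ltac:(lra)) as C.
  replace (hadd (hscal t y) (hscal (1 - t) x)) with (hadd x (hscal t d)) in C
    by (unfold d; vec).
  assert (Q : - (e * (t * hnorm d)) <= f (hadd x (hscal t d)) - f x - t * inner (gf x) d).
  { pose proof (Rle_abs (- (f (hadd x (hscal t d)) - f x - t * inner (gf x) d))) as A.
    rewrite Rabs_Ropp in A. lra. }
  apply Rmult_le_reg_l with t; [exact Ht|]. nra.
Qed.

(** Instead of integrating the gradient, the mean value theorem is applied to [psi], f along the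
    segment minus the linear and quadratic terms of its upper model; the Lipschitz bound makes its
    derivative nonpositive. *)
Lemma descent_lemma {H : Hilbert} (f : H -> R) (gf : H -> H) (L : R) :
  is_gradient f gf -> lipschitz gf L ->
  forall x y, f y <= f x + inner (gf x) (hsub y x) + L / 2 * inner (hsub y x) (hsub y x).
Proof.
  intros Hg Hl x y. set (d := hsub y x).
  pose (psi := fun t => f (hadd x (hscal t d)) - t * inner (gf x) d
                        - t * t * (L / 2 * inner d d)).
  pose (psi' := fun t => inner (gf (hadd x (hscal t d))) d - inner (gf x) d
                         - t * (L * inner d d)).
  pose proof (hnorm_ge0 d) as Nd.
  destruct (MVT_cor2 psi psi' 0 1) as [t [E Ht]]; [lra| |].
  - intros t _.
    assert (D1 : derivable_pt_lim (fun t => f (hadd x (hscal t d))) t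
                   (inner (gf (hadd x (hscal t d))) d)).
    { intros eps He.
      destruct (Hg (hadd x (hscal t d)) (eps / (2 * (hnorm d + 1)))) as [delta [Hd HD]].
      { apply Rdiv_lt_0_compat; lra. }
      assert (Hp : 0 < delta / (hnorm d + 1)) by (apply Rdiv_lt_0_compat; lra).
      exists (mkposreal _ Hp). intros s Hs0 Hs. simpl in Hs.
      assert (Hsd : Rabs s * hnorm d < delta).
      { apply Rle_lt_trans with (Rabs s * (hnorm d + 1)).
        - pose proof (Rabs_pos s). nra.
        - apply Rmult_lt_compat_r with (r := hnorm d + 1) in Hs; [|lra].
          unfold Rdiv in Hs. rewrite Rmult_assoc, Rinv_l in Hs by lra. lra. }
      specialize (HD (hscal s d)). rewrite hnorm_scal in HD. specialize (HD Hsd).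
      rewrite inner_scalr in HD.
      replace (hadd (hadd x (hscal t d)) (hscal s d)) with (hadd x (hscal (t + s) d)) in HD
        by vec.
      set (A := f (hadd x (hscal (t + s) d)) - f (hadd x (hscal t d))) in *.
      set (g0 := inner (gf (hadd x (hscal t d))) d) in *.
      replace (A / s - g0) with ((A - s * g0) / s) by (field; exact Hs0).
      unfold Rdiv. rewrite Rabs_mult, Rabs_inv.
      assert (Ps : 0 < Rabs s) by now apply Rabs_pos_lt.
      apply Rmult_lt_reg_r with (Rabs s); [exact Ps|].
      rewrite Rmult_assoc, Rinv_l, Rmult_1_r by lra.
      eapply Rle_lt_trans; [exact HD|].
      replace (eps / (2 * (hnorm d + 1)) * (Rabs s * hnorm d))
        with (eps * Rabs s * (hnorm d / (2 * (hnorm d + 1)))) by (field; lra).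
      assert (hnorm d / (2 * (hnorm d + 1)) < 1).
      { apply Rmult_lt_reg_r with (2 * (hnorm d + 1)); [lra|].
        unfold Rdiv. rewrite Rmult_assoc, Rinv_l by lra. lra. }
      assert (0 < eps * Rabs s) by now apply Rmult_lt_0_compat.
      nra. }
    unfold psi, psi'. apply derivable_pt_lim_minus; [apply derivable_pt_lim_minus|].
    + exact D1.
    + pose proof (derivable_pt_lim_scal id (inner (gf x) d) t 1 (derivable_pt_lim_id t)) as D.
      rewrite Rmult_1_r in D. eapply derivable_pt_lim_ext; [|exact D].
      intro z. unfold mult_real_fct, id. ring.
    + pose proof (derivable_pt_lim_scal _ (L / 2 * inner d d) t _ (derivable_pt_lim_Rsqr t)) as D.
      replace (t * (L * inner d d)) with (L / 2 * inner d d * (2 * t)) by field.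
      eapply derivable_pt_lim_ext; [|exact D].
      intro z. unfold mult_real_fct, Rsqr. ring.
  - assert (psi' t <= 0).
    { unfold psi'. pose proof (inner_le_norms (hsub (gf (hadd x (hscal t d))) (gf x)) d) as C.
      pose proof (Hl (hadd x (hscal t d)) x) as C2.
      replace (hsub (hadd x (hscal t d)) x) with (hscal t d) in C2 by vec.
      rewrite hnorm_scal, Rabs_pos_eq in C2 by lra.
      pose proof (hnorm_sq d) as S.
      apply Rmult_le_compat_r with (r := hnorm d) in C2; [|exact Nd].
      rewrite <- S. expand. lra. }
    unfold psi in E.
    replace (hadd x (hscal 1 d)) with y in E by (unfold d; vec).
    replace (hadd x (hscal 0 d)) with x in E by (unfold d; vec).
    lra.
Qed.

(* Compare the lower bound from [x] and the descent upper bound from [y] at the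
   point [y - (gf y - gf x)/L], then symmetrize. *)
Lemma baillon_haddad {H : Hilbert} (f : H -> R) (gf : H -> H) (L : R) :
  0 < L -> convex_real f -> is_gradient f gf -> lipschitz gf L ->
  forall x y, inner (hsub (gf x) (gf y)) (hsub (gf x) (gf y))
              <= L * inner (hsub (gf x) (gf y)) (hsub x y).
Proof.
  intros HL Hc Hg Hl.
  assert (half : forall x y,
    f x + inner (gf x) (hsub y x)
      + / (2 * L) * inner (hsub (gf y) (gf x)) (hsub (gf y) (gf x)) <= f y).
  { intros x y. set (e := hsub (gf y) (gf x)).
    set (p := hsub y (hscal (/ L) e)).
    pose proof (gradient_ineq f gf Hc Hg x p) as A.
    pose proof (descent_lemma f gf L Hg Hl y p) as B.
    assert (E1 : inner (gf x) (hsub p x) = inner (gf x) (hsub y x) - / L * inner (gf x) e)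
      by (unfold p; inner_goal; ring).
    replace (hsub p y) with (hscal (- / L) e) in B by (unfold p; vec).
    rewrite inner_scal, !inner_scalr in B.
    assert (E2 : inner e e = inner (gf y) e - inner (gf x) e) by (unfold e at 1; expand; ring).
    replace (L / 2 * (- / L * (- / L * inner e e))) with (/ (2 * L) * inner e e) in B
      by (field; lra).
    assert (E3 : / L * inner e e = 2 * (/ (2 * L) * inner e e)) by (field; lra).
    rewrite E2 in E3 at 1. lra. }
  intros x y. pose proof (half x y) as A. pose proof (half y x) as B.
  assert (E : inner (hsub (gf y) (gf x)) (hsub (gf y) (gf x))
            = inner (hsub (gf x) (gf y)) (hsub (gf x) (gf y))) by (inner_goal; ring).
  rewrite E in A. set (N := inner (hsub (gf x) (gf y)) (hsub (gf x) (gf y))) in *.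
  assert (/ L * N <= inner (hsub (gf x) (gf y)) (hsub x y)).
  { replace (/ L * N) with (/ (2 * L) * N + / (2 * L) * N) by (field; lra).
    clearbody N. clear E. expand. lra. }
  apply Rmult_le_reg_l with (/ L); [now apply Rinv_0_lt_compat|].
  rewrite <- Rmult_assoc, Rinv_l by lra. lra.
Qed.

(** Lower semicontinuity at [l] comes from the tangent at [l], a continuous affine minorant that is
    exact there. *)
Lemma smooth_convex_Gamma0 {H : Hilbert} (f : H -> R) (gf : H -> H) :
  convex_real f -> is_gradient f gf -> Gamma0 (fun x => Fin (f x)).
Proof.
  intros Hc Hg. split; [split|split].
  - exists hzero. discriminate.
  - discriminate.
  - intros x y a b t Ht Ha Hb. simpl in *. pose proof (Hc x y t ltac:(lra)). nra.
  - intros c u l Hu Hcv. simpl in *.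
    assert (f l - c <= 0); [|lra].
    apply le_of_small with (hnorm (gf l)). intros e He.
    destruct (Hcv e) as [n Hn]; [lra|]. specialize (Hn n (le_n n)).
    pose proof (gradient_ineq f gf Hc Hg l (u n)) as A. specialize (Hu n).
    pose proof (inner_ge_norms (gf l) (hsub (u n) l)) as C.
    pose proof (hnorm_ge0 (gf l)). nra.
Qed.

(** * Proximal points *)

(** Expresses that [s] belongs to tau times the subdifferential at [p]. Without a division by [tau],
    the inclusions given by proximal points can be added directly. *)
Definition scaled_subdiff {H : Hilbert} (tau : R) (phi : H -> ERbar) (p s : H) : Prop :=
  exists a, phi p = Fin a /\
    forall u c, phi u = Fin c -> tau * a + inner s (hsub u p) <= tau * c.

Lemma subdiff_scaled {H : Hilbert} (tau : R) (phi : H -> ERbar) (p s : H) :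
  0 < tau -> subdiff phi p s -> scaled_subdiff tau phi p (hscal tau s).
Proof.
  intros Ht [a [Ea Ha]]. exists a. split; [exact Ea|].
  intros u c Ec. specialize (Ha u). rewrite Ec in Ha. simpl in Ha.
  rewrite inner_scal. nra.
Qed.

(** Fermat's rule: compare [p] with p + t (y - p), bound phi there by convexity, divide by t and let
    t tend to 0. *)
Lemma prox_scaled_subdiff {H : Hilbert} (lam : R) (phi : H -> ERbar) (u p : H) :
  0 < lam -> proper phi -> convex_fun phi -> is_prox lam phi u p ->
  scaled_subdiff lam phi p (hsub u p).
Proof.
  intros Hlam [[x0 Hx0] Pm] Hc Hp.
  assert (Hfin : exists a, phi p = Fin a).
  { specialize (Hp x0). pose proof (Pm p). pose proof (Pm x0).
    destruct (phi p) as [a| |]; [now exists a| |easy].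
    destruct (phi x0); simpl in Hp; easy. }
  destruct Hfin as [a Ha]. exists a. split; [exact Ha|].
  intros y c Hy. set (d := hsub y p).
  assert (lam * a + inner (hsub u p) d - lam * c <= 0); [|lra].
  apply le_of_small with (/2 * inner d d). intros t Ht.
  pose proof (Hc y p c a t Ht) as C. rewrite Hy, Ha in C.
  specialize (C (Rle_refl _) (Rle_refl _)).
  specialize (Hp (hadd (hscal t y) (hscal (1 - t) p))).
  pose proof (Pm (hadd (hscal t y) (hscal (1 - t) p))) as Pt.
  rewrite Ha in Hp.
  destruct (phi (hadd (hscal t y) (hscal (1 - t) p))) as [b| |]; [|easy|easy].
  simpl in Hp, C.
  assert (E : inner (hsub (hadd (hscal t y) (hscal (1 - t) p)) u)
                    (hsub (hadd (hscal t y) (hscal (1 - t) p)) u)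
    = inner (hsub p u) (hsub p u) - 2 * t * inner (hsub u p) d + t * t * inner d d)
    by (unfold d; inner_goal; ring).
  rewrite E in Hp.
  apply Rmult_le_reg_l with t; [lra|].
  assert (lam * b <= lam * (t * c + (1 - t) * a)) by (apply Rmult_le_compat_l; lra).
  lra.
Qed.

(** The known subgradient supplies an affine minorant, so the objective is bounded below with
    bounded sublevel sets. These are convex and nested, and a common adherent point is a minimizer
    by lower semicontinuity. *)
Lemma prox_exists {H : Hilbert} (mu : R) (phi : H -> ERbar) (u x0 s : H) :
  0 < mu -> Gamma0 phi -> subdiff phi x0 s -> exists p, is_prox mu phi u p.
Proof.
  intros Hmu [[_ Pm] [Hc Hl]] [a0 [Ha0 Hs]].
  pose (val := fun x r => exists a, phi x = Fin a /\ r = /2 * inner (hsub x u) (hsub x u) + mu * a).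
  (* completing the square in the affine minorant of [phi] *)
  pose (e := hsub u (hscal mu s)).
  pose (k := mu * a0 - mu * inner s x0 + /2 * inner u u - /2 * inner e e).
  assert (low : forall x r, val x r -> /2 * inner (hsub x e) (hsub x e) + k <= r).
  { intros x r [a [Ha ->]]. specialize (Hs x). rewrite Ha in Hs. simpl in Hs.
    apply Rmult_le_compat_l with (r := mu) in Hs; [|lra].
    assert (E : /2 * inner (hsub x e) (hsub x e) + k
      = /2 * inner (hsub x u) (hsub x u) + mu * (a0 + inner s (hsub x x0)))
      by (unfold k, e; inner_goal; field).
    lra. }
  destruct (infimum_exists (fun r => exists x, val x r) k) as [i [Hi1 Hi2]].
  { exists (/2 * inner (hsub x0 u) (hsub x0 u) + mu * a0), x0, a0. auto. }
  { intros r [x Hx]. apply low in Hx. pose proof (inner_pos _ (hsub x e)). lra. }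
  destruct (nested_convex_adherent
    (fun n x => exists r, val x r /\ r <= i + / (INR n + 1))
    (4 * (i + 1 - k) + 2 * inner e e)) as [p Hp].
  - intros n x y t Ht [r1 [[a [Ha ->]] L1]] [r2 [[b [Hb ->]] L2]].
    pose proof (Hc x y a b t Ht) as C. rewrite Ha, Hb in C.
    specialize (C (Rle_refl _) (Rle_refl _)).
    pose proof (Pm (hadd (hscal t x) (hscal (1 - t) y))) as Pt.
    destruct (phi (hadd (hscal t x) (hscal (1 - t) y))) as [c| |] eqn:Ec; [|easy|easy].
    simpl in C. eexists. split; [exists c; split; [exact Ec | reflexivity]|].
    assert (E : inner (hsub (hadd (hscal t x) (hscal (1 - t) y)) u)
                  (hsub (hadd (hscal t x) (hscal (1 - t) y)) u)
      = t * inner (hsub x u) (hsub x u) + (1 - t) * inner (hsub y u) (hsub y u)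
        - t * (1 - t) * inner (hsub x y) (hsub x y)) by (inner_goal; ring).
    pose proof (inner_pos _ (hsub x y)) as P.
    assert (0 <= t * (1 - t) * inner (hsub x y) (hsub x y)).
    { apply Rmult_le_pos; [nra | exact P]. }
    assert (mu * c <= mu * (t * a + (1 - t) * b)) by (apply Rmult_le_compat_l; lra).
    apply Rmult_le_compat_l with (r := t) in L1; [|lra].
    apply Rmult_le_compat_l with (r := 1 - t) in L2; [|lra].
    lra.
  - intro n. destruct (Hi2 (/ (INR n + 1))) as [r [[x Hx] Hr]].
    { apply Rinv_0_lt_compat. pose proof (pos_INR n). lra. }
    exists x, r. split; [exact Hx | lra].
  - intros n q x Hnq [r [Hv Hr]]. exists r. split; [exact Hv|].
    apply Rle_trans with (1 := Hr). apply Rplus_le_compat_l, Rinv_le_contravar.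
    + pose proof (pos_INR n). lra.
    + apply le_INR in Hnq. lra.
  - intros x [r [Hv Hr]]. apply low in Hv. simpl in Hr.
    rewrite Rplus_0_l, Rinv_1 in Hr.
    pose proof (inner_pos _ (hsub x (hscal 2 e))) as Q.
    assert (inner (hsub x e) (hsub x e) <= 2 * (i + 1 - k)) as B by lra.
    revert B Q. inner_goal. intros B Q. lra.
  - exists p.
    assert (Ep : Ele (phi p) (Fin ((i - /2 * inner (hsub p u) (hsub p u)) / mu))).
    { apply Ele_eps. intros eps He. apply lsc_adherent; [exact Hl|]. intros d Hd.
      set (N := hnorm (hsub p u)). assert (HN : 0 <= N) by apply hnorm_ge0.
      (* The allowance mu eps is shared equally: half for the cross term <p - u, x - p> of the
         quadratic, half for the excess of the value over the infimum. *)
      set (d' := Rmin d (mu * eps / (2 * (N + 1)))).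
      assert (0 < mu * eps) by now apply Rmult_lt_0_compat.
      assert (Hd' : 0 < d') by (apply Rmin_glb_lt; [|apply Rdiv_lt_0_compat]; lra).
      assert (Hd'N : N * d' <= mu * eps / 2).
      { apply Rle_trans with (N * (mu * eps / (2 * (N + 1)))).
        - apply Rmult_le_compat_l; [exact HN | apply Rmin_r].
        - apply Rmult_le_reg_r with (2 * (N + 1)); [lra|].
          replace (N * (mu * eps / (2 * (N + 1))) * (2 * (N + 1)))
            with (N * (mu * eps)) by (field; lra). nra. }
      destruct (nat_inv_small (mu * eps / 2)) as [n Hn]; [lra|].
      specialize (Hn n (le_n n)).
      destruct (Hp n d' Hd') as [x [[r [[a [Ha ->]] Hr]] Hx]].
      exists x. split; [|eapply Rlt_le_trans; [exact Hx | apply Rmin_l]].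
      rewrite Ha. simpl.
      pose proof (inner_ge_norms (hsub p u) (hsub x p)) as C. fold N in C.
      assert (N * hnorm (hsub x p) <= N * d') by (apply Rmult_le_compat_l; lra).
      assert (E : inner (hsub x u) (hsub x u) = inner (hsub p u) (hsub p u)
         + 2 * inner (hsub p u) (hsub x p) + inner (hsub x p) (hsub x p))
        by (inner_goal; ring).
      pose proof (inner_pos _ (hsub x p)).
      apply Rmult_le_reg_l with mu; [exact Hmu|].
      replace (mu * ((i - /2 * inner (hsub p u) (hsub p u)) / mu + eps))
        with (i - /2 * inner (hsub p u) (hsub p u) + mu * eps) by (field; lra).
      lra. }
    pose proof (Pm p) as Pp.
    destruct (phi p) as [b| |] eqn:Eb; [|easy|easy]. simpl in Ep.
    assert (Hb : /2 * inner (hsub p u) (hsub p u) + mu * b <= i).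
    { apply Rmult_le_compat_l with (r := mu) in Ep; [|lra].
      replace (mu * ((i - /2 * inner (hsub p u) (hsub p u)) / mu))
        with (i - /2 * inner (hsub p u) (hsub p u)) in Ep by (field; lra). lra. }
    intros z. rewrite Eb. pose proof (Pm z) as Pz.
    destruct (phi z) as [c| |] eqn:Ec; [|exact I|easy]. simpl.
    apply Rle_trans with (1 := Hb). apply Hi1. exists z, c. auto.
Qed.

Lemma Esup_ge (S : R -> Prop) (r : R) : S r -> Ele (Fin r) (Esup S).
Proof.
  intros Hr. unfold Esup.
  destruct (excluded_middle_informative (exists x, S x)) as [ne|N].
  - destruct (excluded_middle_informative (bound S)) as [b|N]; [|exact I].
    destruct (completeness S b ne) as [s Hs]. simpl. now apply Hs.
  - exfalso. apply N. now exists r.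
Qed.

Lemma Esup_le (S : R -> Prop) (r : R) :
  (forall s, S s -> s <= r) -> Ele (Esup S) (Fin r).
Proof.
  intros Hr. unfold Esup.
  destruct (excluded_middle_informative (exists x, S x)) as [ne|N]; [|exact I].
  destruct (excluded_middle_informative (bound S)) as [b|N].
  - destruct (completeness S b ne) as [s Hs]. simpl. now apply Hs.
  - exfalso. apply N. exists r. exact Hr.
Qed.

(* Moreau decomposition: with [q] the proximal point of [phi] at [u/mu],
   [u - mu q] is a subgradient of [phi] at [q] and minimizes the objective of
   the conjugate proximal problem, whose minimizer is unique. *)
Lemma prox_conj_subdiff {H : Hilbert} (mu : R) (phi : H -> ERbar) (u p x0 s : H) :
  0 < mu -> Gamma0 phi -> subdiff phi x0 s -> is_prox mu (fconj phi) u p ->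
  scaled_subdiff 1 phi (hscal (/ mu) (hsub u p)) p.
Proof.
  intros Hmu HG Hsub Hp.
  assert (Hmu' : 0 < / mu) by now apply Rinv_0_lt_compat.
  destruct (prox_exists (/ mu) phi (hscal (/ mu) u) x0 s Hmu' HG Hsub) as [q Hq].
  destruct HG as [HP [Hc Hl]].
  apply prox_scaled_subdiff in Hq; [|assumption..].
  destruct Hq as [a [Ha Hq]].
  set (p' := hsub u (hscal mu q)).
  assert (Hp' : forall z c, phi z = Fin c -> a + inner p' (hsub z q) <= c).
  { intros z c Hz. specialize (Hq z c Hz).
    assert (E : inner (hsub (hscal (/ mu) u) q) (hsub z q) = / mu * inner p' (hsub z q)).
    { unfold p'. inner_goal. field. lra. }
    rewrite E in Hq. apply Rmult_le_reg_l with (/ mu); [exact Hmu'|]. lra. }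
  assert (Up : Ele (fconj phi p') (Fin (inner q p' - a))).
  { apply Esup_le. intros r [z [c [Hz ->]]]. specialize (Hp' z c Hz).
    revert Hp'. inner_goal. lra. }
  assert (Lo : Ele (Fin (inner q p - a)) (fconj phi p)).
  { apply Esup_ge. exists q, a. auto. }
  assert (Lo' : Ele (Fin (inner q p' - a)) (fconj phi p')).
  { apply Esup_ge. exists q, a. auto. }
  specialize (Hp p').
  destruct (fconj phi p') as [c'| |]; [|easy|easy].
  destruct (fconj phi p) as [c| |]; [|easy|easy].
  simpl in *.
  assert (Epp : p = p').
  { apply sub_eq0.
    assert (mu * (inner q p - a) <= mu * c) by (apply Rmult_le_compat_l; lra).
    assert (mu * c' <= mu * (inner q p' - a)) by (apply Rmult_le_compat_l; lra).
    (* The affine minorant <q, .> - a of the conjugate is exact at p'. Since u - p' = mu q, the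
       linear terms cancel, and the objective at p exceeds that at p' by at least |p - p'|^2 / 2. *)
    assert (E : /2 * inner (hsub p u) (hsub p u) + mu * inner q p
      - (/2 * inner (hsub p' u) (hsub p' u) + mu * inner q p')
      = /2 * inner (hsub p p') (hsub p p')).
    { unfold p'. inner_goal. field. }
    lra. }
  assert (Eq : hscal (/ mu) (hsub u p) = q).
  { rewrite Epp. unfold p'. vec. lra. }
  rewrite Eq, Epp. exists a. split; [exact Ha|].
  intros z c0 Hz. specialize (Hp' z c0 Hz). lra.
Qed.

(** * The primal-dual iteration with a single dual variable *)

Lemma adjoint_sub {H G : Hilbert} (K : H -> G) (Ks : G -> H) :
  is_adjoint K Ks -> forall x y, K (hsub x y) = hsub (K x) (K y).
Proof.
  intros HK x y. apply inner_ext. intro z.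
  rewrite HK. expand. rewrite <- !HK. reflexivity.
Qed.

Lemma adjoint_comb {H G : Hilbert} (K : H -> G) (Ks : G -> H) :
  is_adjoint K Ks -> forall t x y,
    K (hadd (hscal t x) (hscal (1 - t) y)) = hadd (hscal t (K x)) (hscal (1 - t) (K y)).
Proof.
  intros HK t x y. apply inner_ext. intro z.
  rewrite HK. expand. rewrite <- !HK. reflexivity.
Qed.

(** Primal-dual optimality; [z] is [tau] times the usual multiplier. *)
Definition kkt {H G : Hilbert} (tau : R) (gf : H -> H) (g : H -> ERbar) (h : G -> ERbar)
  (K : H -> G) (Ks : G -> H) (x : H) (z : G) : Prop :=
  scaled_subdiff tau g x (hopp (hadd (hscal tau (gf x)) (Ks z))) /\
  scaled_subdiff tau h (K x) z.

(* The inequalities for [g] are used along the cycle x+ -> xs -> v -> x+; with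
   this orientation the terms in [K] collapse to [<z+ - z, K (x+ - v)>]. *)
Lemma energy_step {H G : Hilbert} (tau : R) (gf : H -> H) (g : H -> ERbar) (h : G -> ERbar)
  (K : H -> G) (Ks : G -> H) (xs x v x' : H) (zs z z' : G) :
  is_adjoint K Ks ->
  kkt tau gf g h K Ks xs zs ->
  scaled_subdiff tau g v (hsub (hsub (hsub x v) (hscal tau (gf x))) (Ks z)) ->
  scaled_subdiff tau g x' (hsub (hsub (hsub x x') (hscal tau (gf x))) (Ks z')) ->
  scaled_subdiff tau h (hadd (hsub z z') (K v)) z' ->
  inner (hsub x' xs) (hsub x' xs) + inner (hsub z' zs) (hsub z' zs)
  + (inner (hsub x v) (hsub x v) + 2 * tau * inner (hsub (gf x) (gf xs)) (hsub v x)
     + 2 * tau * inner (hsub (gf x) (gf xs)) (hsub x xs))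
  + (inner (hsub x' v) (hsub x' v) + inner (hsub z' z) (hsub z' z)
     + 2 * inner (hsub z' z) (K (hsub x' v)))
  <= inner (hsub x xs) (hsub x xs) + inner (hsub z zs) (hsub z zs).
Proof.
  intros HK [[gs [Egs Hgs]] [hs [Ehs Hhs]]] [gv [Egv Hgv]] [gx [Egx Hgx]] [hb [Ehb Hhb]].
  specialize (Hgx xs gs Egs). specialize (Hgv x' gx Egx). specialize (Hgs v gv Egv).
  specialize (Hhb (K xs) hs Ehs). specialize (Hhs _ hb Ehb).
  rewrite (adjoint_sub K Ks HK).
  assert (A : forall q a, inner (Ks q) a = inner (K a) q).
  { intros q a. rewrite HK. apply inner_sym. }
  revert Hgx Hgv Hgs Hhb Hhs. expand. rewrite !A. orient. intros. lra.
Qed.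

(** The two brackets of the energy estimate are coercive separately: the one with the gradient keeps
    the margin 1 - tau L / 2, the one with [K] keeps (1 - kappa) / 2. The constant is the smaller
    margin. *)
Lemma energy_decrease {H G : Hilbert} (f : H -> R) (gf : H -> H) (L tau : R)
  (g : H -> ERbar) (h : G -> ERbar) (K : H -> G) (Ks : G -> H) (kappa : R) :
  0 < L -> convex_real f -> is_gradient f gf -> lipschitz gf L ->
  0 < tau < 2 / L -> 0 <= kappa < 1 ->
  (forall x, inner (K x) (K x) <= kappa * inner x x) ->
  is_adjoint K Ks ->
  exists c, 0 < c /\ forall xs x v x' zs z z',
  kkt tau gf g h K Ks xs zs ->
  scaled_subdiff tau g v (hsub (hsub (hsub x v) (hscal tau (gf x))) (Ks z)) ->
  scaled_subdiff tau g x' (hsub (hsub (hsub x x') (hscal tau (gf x))) (Ks z')) ->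
  scaled_subdiff tau h (hadd (hsub z z') (K v)) z' ->
  inner (hsub x' xs) (hsub x' xs) + inner (hsub z' zs) (hsub z' zs)
  + c * (inner (hsub x v) (hsub x v) + inner (hsub x' v) (hsub x' v)
         + inner (hsub z' z) (hsub z' z))
  <= inner (hsub x xs) (hsub x xs) + inner (hsub z zs) (hsub z zs).
Proof.
  intros HL Hc Hg Hl Htau Hk HKb HK.
  assert (HtL : tau * L < 2).
  { destruct Htau as [_ T]. apply Rmult_lt_compat_r with (r := L) in T; [|exact HL].
    replace (2 / L * L) with 2 in T by (field; lra). exact T. }
  exists (Rmin (1 - tau * L / 2) ((1 - kappa) / 2)). split.
  { apply Rmin_glb_lt; lra. }
  intros xs x v x' zs z z' Hkkt Hv Hx Hz.
  pose proof (energy_step tau gf g h K Ks xs x v x' zs z z' HK Hkkt Hv Hx Hz) as E.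
  pose proof (baillon_haddad f gf L HL Hc Hg Hl x xs) as Co.
  set (d := hsub (gf x) (gf xs)) in *.
  pose proof (Rmin_l (1 - tau * L / 2) ((1 - kappa) / 2)) as C1.
  pose proof (Rmin_r (1 - tau * L / 2) ((1 - kappa) / 2)) as C2.
  set (c := Rmin (1 - tau * L / 2) ((1 - kappa) / 2)) in *.
  assert (T1 : (1 - tau * L / 2) * inner (hsub x v) (hsub x v)
    <= inner (hsub x v) (hsub x v) + 2 * tau * inner d (hsub v x)
       + 2 * tau * inner d (hsub x xs)).
  (* With weight L / 2, Young's inequality costs (2 / L) |d|^2, exactly what cocoercivity returns
     through 2 <d, x - xs>. *)
  { assert (Hs : 0 < L / 2) by lra.
    pose proof (young_inner (L / 2) (hsub v x) d Hs) as Y.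
    replace (/ (L / 2)) with (2 * / L) in Y by (field; lra).
    assert (Co' : / L * inner d d <= inner d (hsub x xs)).
    { apply Rmult_le_reg_l with L; [exact HL|].
      rewrite <- Rmult_assoc, Rinv_r by lra. lra. }
    assert (S1 : inner (hsub v x) (hsub v x) = inner (hsub x v) (hsub x v))
      by (inner_goal; ring).
    rewrite S1, (inner_sym _ (hsub v x) d) in Y.
    assert (0 <= 2 * inner d (hsub v x) + L / 2 * inner (hsub x v) (hsub x v)
              + 2 * inner d (hsub x xs)) by lra.
    assert (0 <= tau * (2 * inner d (hsub v x) + L / 2 * inner (hsub x v) (hsub x v)
              + 2 * inner d (hsub x xs))) by (apply Rmult_le_pos; lra).
    lra. }
  assert (T2 : (1 - kappa) / 2 * (inner (hsub x' v) (hsub x' v) + inner (hsub z' z) (hsub z' z))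
    <= inner (hsub x' v) (hsub x' v) + inner (hsub z' z) (hsub z' z)
       + 2 * inner (hsub z' z) (K (hsub x' v))).
  { set (a := hsub x' v). set (q := hsub z' z).
    (* This weight leaves the same margin on both squares, because ((1 + kappa) / 2)^2 - kappa = ((1
       - kappa) / 2)^2 >= 0. *)
    assert (Hs : 0 < (1 + kappa) / 2) by lra.
    pose proof (young_inner ((1 + kappa) / 2) q (K a) Hs) as Y.
    pose proof (inner_pos _ a) as Pa. pose proof (HKb a) as B.
    assert (/ ((1 + kappa) / 2) * inner (K a) (K a) <= (1 + kappa) / 2 * inner a a).
    { apply Rmult_le_reg_l with ((1 + kappa) / 2); [lra|].
      rewrite <- Rmult_assoc, Rinv_r by lra.
      pose proof (Rmult_le_pos _ _ (Rle_0_sqr (1 - kappa)) Pa). unfold Rsqr in *. lra. }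
    lra. }
  pose proof (inner_pos _ (hsub x v)) as P1. pose proof (inner_pos _ (hsub x' v)) as P2.
  pose proof (inner_pos _ (hsub z' z)) as P3.
  assert (c * inner (hsub x v) (hsub x v) <= (1 - tau * L / 2) * inner (hsub x v) (hsub x v))
    by (apply Rmult_le_compat_r; lra).
  assert (c * (inner (hsub x' v) (hsub x' v) + inner (hsub z' z) (hsub z' z))
    <= (1 - kappa) / 2 * (inner (hsub x' v) (hsub x' v) + inner (hsub z' z) (hsub z' z)))
    by (apply Rmult_le_compat_r; lra).
  lra.
Qed.

(* The saddle inequality [f + g + h >= f(x) + g(x) + h(Kx) + <z, q - Ku>] for all
   [u], [q] is the form of optimality that passes to limits of convex combinations. *)
Lemma saddle_kkt {H G : Hilbert} (f : H -> R) (gf : H -> H) (L tau : R)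
  (g : H -> ERbar) (h : G -> ERbar) (K : H -> G) (Ks : G -> H) (x : H) (z : G) :
  is_gradient f gf -> lipschitz gf L -> 0 < tau ->
  Gamma0 g -> Gamma0 h -> is_adjoint K Ks ->
  (forall u q r,
     Ele (Eplus (Fin (f u)) (Eplus (g u) (h q))) (Fin r) ->
     Ele (Eplus (Fin (f x)) (Eplus (g x) (h (K x))))
         (Fin (r - / tau * inner z (hsub q (K u))))) ->
  kkt tau gf g h K Ks x z.
Proof.
  intros Hg Hl Ht [[[u0 Hu0] Pg] [Cg _]] [[[q0 Hq0] Ph] _] HK Hs.
  assert (F : exists a a', g x = Fin a /\ h (K x) = Fin a').
  { pose proof (Pg u0). pose proof (Ph q0).
    destruct (g u0) as [b| |] eqn:Eg; [|easy|easy].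
    destruct (h q0) as [b'| |] eqn:Eh; [|easy|easy].
    specialize (Hs u0 q0 (f u0 + (b + b'))). rewrite Eg, Eh in Hs.
    specialize (Hs (Rle_refl _)).
    pose proof (Pg x). pose proof (Ph (K x)).
    destruct (g x) as [a| |]; [|easy|easy]. destruct (h (K x)) as [a'| |]; [|easy|easy].
    now exists a, a'. }
  destruct F as [a [a' [Ea Ea']]]. rewrite Ea, Ea' in Hs. simpl in Hs.
  assert (Hs' : forall u q b b', g u = Fin b -> h q = Fin b' ->
    tau * (f x + (a + a')) + inner z (hsub q (K u)) <= tau * (f u + (b + b'))).
  { intros u q b b' Eb Eb'. specialize (Hs u q (f u + (b + b'))).
    rewrite Eb, Eb' in Hs. specialize (Hs (Rle_refl _)). simpl in Hs.
    apply Rmult_le_compat_l with (r := tau) in Hs; [|lra].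
    rewrite Rmult_minus_distr_l, <- Rmult_assoc, Rinv_r, Rmult_1_l in Hs by lra. lra. }
  split.
  - exists a. split; [exact Ea|]. intros u c Ec. set (d := hsub u x).
    assert (tau * a + inner (hopp (hadd (hscal tau (gf x)) (Ks z))) d - tau * c <= 0); [|lra].
    apply le_of_small with (tau * (L / 2) * inner d d). intros t Hti.
    pose proof (Cg u x c a t Hti) as C. rewrite Ec, Ea in C.
    specialize (C (Rle_refl _) (Rle_refl _)).
    (* The competitor (p, K x) cancels the h terms; the descent lemma replaces f p - f x by t <gf x,
       d> with an error of order t^2, which vanishes after division by t. *)
    set (p := hadd (hscal t u) (hscal (1 - t) x)) in *.
    pose proof (Pg p) as Pp. destruct (g p) as [b| |] eqn:Eb; [|easy|easy].
    simpl in C.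
    pose proof (Hs' p (K x) b a' Eb Ea') as S.
    pose proof (descent_lemma f gf L Hg Hl x p) as D.
    replace (hsub p x) with (hscal t d) in D by (unfold p, d; vec).
    rewrite inner_scal, !inner_scalr in D.
    replace (hsub (K x) (K p)) with (hopp (hscal t (K d))) in S.
    2:{ unfold p, d. rewrite (adjoint_comb K Ks HK), (adjoint_sub K Ks HK). vec. }
    rewrite inner_oppr, inner_scalr in S.
    rewrite inner_oppl, inner_add, inner_scal, (inner_sym _ (Ks z)), <- HK, (inner_sym _ (K d)).
    apply Rmult_le_reg_l with t; [lra|].
    apply Rmult_le_compat_l with (r := tau) in D; [|lra].
    apply Rmult_le_compat_l with (r := tau) in C; [|lra].
    lra.
  - exists a'. split; [exact Ea'|]. intros q c Ec.
    pose proof (Hs' x q a c Ea Ec). lra.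
Qed.

(** c * D k is at most V k - V (S k), and V converges, being decreasing and nonnegative. *)
Lemma summable_steps (V D : nat -> R) (c : R) :
  0 < c -> (forall k, 0 <= V k) -> (forall k, V (S k) + c * D k <= V k) ->
  (forall k, 0 <= D k) ->
  forall eps, 0 < eps -> exists N, forall k, (k >= N)%nat -> D k < eps.
Proof.
  intros Hc HV Hstep HD eps He.
  destruct (decreasing_cv V) as [l Hl].
  - intro k. specialize (Hstep k). specialize (HD k). nra.
  - exists 0. intros r [k ->]. unfold opp_seq. specialize (HV k). lra.
  - destruct (Hl (c * eps / 2)) as [N HN].
    { assert (0 < c * eps) by now apply Rmult_lt_0_compat. lra. }
    exists N. intros k Hk.
    pose proof (HN k Hk) as A. pose proof (HN (S k) ltac:(lia)) as B.
    unfold Rdist in *. apply Rabs_def2 in A. apply Rabs_def2 in B.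
    specialize (Hstep k). apply Rmult_lt_reg_l with c; [exact Hc|]. lra.
Qed.

Lemma hnorm_comb_le {H : Hilbert} (a a' b b' : H) (t r : R) :
  0 < t < 1 -> hnorm (hsub a b) <= r -> hnorm (hsub a' b') <= r ->
  hnorm (hsub (hadd (hscal t a) (hscal (1 - t) a')) (hadd (hscal t b) (hscal (1 - t) b')))
    <= r.
Proof.
  intros Ht Ha Hb.
  replace (hsub (hadd (hscal t a) (hscal (1 - t) a')) (hadd (hscal t b) (hscal (1 - t) b')))
    with (hadd (hscal t (hsub a b)) (hscal (1 - t) (hsub a' b'))) by vec.
  eapply Rle_trans; [apply hnorm_triangle|].
  rewrite !hnorm_scal, !Rabs_pos_eq by lra. nra.
Qed.

Theorem primal_dual_weak_cv {H G : Hilbert} (f : H -> R) (gf : H -> H) (L tau : R)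
  (g : H -> ERbar) (h : G -> ERbar) (K : H -> G) (Ks : G -> H) (kappa : R)
  (x v : nat -> H) (z : nat -> G) :
  0 < L -> convex_real f -> is_gradient f gf -> lipschitz gf L ->
  0 < tau < 2 / L -> 0 <= kappa < 1 ->
  (forall a, inner (K a) (K a) <= kappa * inner a a) ->
  is_adjoint K Ks -> Gamma0 g -> Gamma0 h ->
  (exists xs zs, kkt tau gf g h K Ks xs zs) ->
  (forall k, scaled_subdiff tau g (v k)
     (hsub (hsub (hsub (x k) (v k)) (hscal tau (gf (x k)))) (Ks (z k)))) ->
  (forall k, scaled_subdiff tau g (x (S k))
     (hsub (hsub (hsub (x k) (x (S k))) (hscal tau (gf (x k)))) (Ks (z (S k))))) ->
  (forall k, scaled_subdiff tau h (hadd (hsub (z k) (z (S k))) (K (v k))) (z (S k))) ->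
  exists xs zs, kkt tau gf g h K Ks xs zs /\ weak_cv x xs.
Proof.
  intros HL Hc Hgrad Hl Htau Hk HKb HK HG HH Hex Hv Hx Hz.
  destruct (energy_decrease f gf L tau g h K Ks kappa HL Hc Hgrad Hl Htau Hk HKb HK)
    as [c0 [Hc0 Hen]].
  pose (X := fun k => (x k, z k) : prodH H G).
  (* The point at which [z (S k)] is a scaled subgradient of h; it differs from K (x (S k)) only by
     residuals. *)
  pose (b := fun k => hadd (hsub (z k) (z (S k))) (K (v k))).
  assert (step : forall xs zs k, kkt tau gf g h K Ks xs zs ->
    inner (hsub (X (S k)) (xs, zs)) (hsub (X (S k)) (xs, zs))
    + c0 * (inner (hsub (x k) (v k)) (hsub (x k) (v k))
            + inner (hsub (x (S k)) (v k)) (hsub (x (S k)) (v k))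
            + inner (hsub (z (S k)) (z k)) (hsub (z (S k)) (z k)))
    <= inner (hsub (X k) (xs, zs)) (hsub (X k) (xs, zs))).
  { intros xs zs k Hkkt. now apply (Hen xs (x k) (v k) (x (S k)) zs (z k) (z (S k))). }
  destruct Hex as [x0 [z0 Hkkt0]].
  assert (Res : forall eps, 0 < eps -> exists N, forall k, (k >= N)%nat ->
     hnorm (hsub (x k) (v k)) < eps /\ hnorm (hsub (x (S k)) (v k)) < eps /\
     hnorm (hsub (z (S k)) (z k)) < eps).
  { intros eps He.
    destruct (summable_steps
      (fun k => inner (hsub (X k) (x0, z0)) (hsub (X k) (x0, z0)))
      (fun k => inner (hsub (x k) (v k)) (hsub (x k) (v k))
            + inner (hsub (x (S k)) (v k)) (hsub (x (S k)) (v k))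
            + inner (hsub (z (S k)) (z k)) (hsub (z (S k)) (z k))) c0 Hc0) with (eps * eps)
      as [N HN].
    - intro k. apply (inner_pos (prodH H G)).
    - intro k. now apply step.
    - intro k. repeat apply Rplus_le_le_0_compat; apply inner_pos.
    - now apply Rmult_lt_0_compat.
    - exists N. intros k HkN. specialize (HN k HkN).
      pose proof (inner_pos _ (hsub (x k) (v k))).
      pose proof (inner_pos _ (hsub (x (S k)) (v k))).
      pose proof (inner_pos _ (hsub (z (S k)) (z k))).
      unfold hnorm. rewrite <- (sqrt_square eps) by lra.
      repeat split; apply sqrt_lt_1_alt; split; try assumption; lra. }
  set (V0 := inner (hsub (X O) (x0, z0)) (hsub (X O) (x0, z0))).
  assert (Bd : forall k, hnorm (hsub (X k) (x0, z0)) <= sqrt V0).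
  { intro k. apply sqrt_le_1_alt. induction k; [unfold V0; lra|].
    eapply Rle_trans; [|exact IHk]. pose proof (step x0 z0 k Hkkt0) as S1.
    pose proof (inner_pos _ (hsub (x k) (v k))).
    pose proof (inner_pos _ (hsub (x (S k)) (v k))).
    pose proof (inner_pos _ (hsub (z (S k)) (z k))).
    eapply Rle_trans; [|exact S1].
    rewrite <- Rplus_0_r at 1. apply Rplus_le_compat_l, Rmult_le_pos; lra. }
  assert (Bx : forall k u, hnorm (hsub u (x k)) <= hnorm (hsub u x0) + sqrt V0).
  { intros k u. eapply Rle_trans; [apply (hnorm_sub_triangle _ x0)|].
    apply Rplus_le_compat_l. rewrite hnorm_sub_sym.
    eapply Rle_trans; [|apply (Bd k)]. exact (hnorm_fst_le (hsub (X k) (x0, z0))). }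
  assert (Bz : forall k, hnorm (z k) <= hnorm z0 + sqrt V0).
  { intros k. replace (z k) with (hadd z0 (hsub (z k) z0)) by vec.
    eapply Rle_trans; [apply hnorm_triangle|]. apply Rplus_le_compat_l.
    eapply Rle_trans; [|apply (Bd k)]. exact (hnorm_snd_le (hsub (X k) (x0, z0))). }
  assert (Bg : forall k, hnorm (gf (x k)) <= hnorm (gf x0) + L * sqrt V0).
  { intros k. replace (gf (x k)) with (hadd (gf x0) (hsub (gf (x k)) (gf x0))) by vec.
    eapply Rle_trans; [apply hnorm_triangle|]. apply Rplus_le_compat_l.
    eapply Rle_trans; [apply Hl|]. apply Rmult_le_compat_l; [lra|].
    eapply Rle_trans; [|apply (Bd k)]. exact (hnorm_fst_le (hsub (X k) (x0, z0))). }
  assert (HKn : forall a, hnorm (K a) <= hnorm a).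
  { intro a. apply sqrt_le_1_alt. pose proof (HKb a). pose proof (inner_pos _ a). nra. }
  pose (Phi := sum_fun (fun u => Fin (f u)) (sum_fun g h)).
  assert (GPhi : Gamma0 Phi).
  { apply sum_fun_Gamma0; [now apply smooth_convex_Gamma0 with gf|].
    now apply sum_fun_Gamma0. }
  destruct GPhi as [_ [CPhi LPhi]].
  (* The saddle inequality up to eps, with f at [x k], g at [x (S k)] and h at [b k]. Adding the
     three inequalities cancels <Ks z, x> against <z, K x>. *)
  assert (Approx : forall u q r, Ele (Phi (u, (u, q))) (Fin r) ->
    forall eps, 0 < eps -> exists N, forall k, (k >= N)%nat ->
      hnorm (hsub (x k) (x (S k))) < eps /\ hnorm (hsub (b k) (K (x (S k)))) < eps /\
      Ele (Phi (x k, (x (S k), b k)))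
          (Fin (r + eps - / tau * inner (z (S k)) (hsub q (K u))))).
  { intros u q r Hr eps He.
    (* Sums the Fejer bounds on |u - x (S k)|, tau |gf (x k)| and |z (S k)|, the factors that
       multiply residuals below 2 d in [Err]. *)
    set (M := hnorm (hsub u x0) + sqrt V0 + tau * (hnorm (gf x0) + L * sqrt V0)
              + (hnorm z0 + sqrt V0)).
    assert (HM : 0 <= M).
    { unfold M. pose proof (hnorm_ge0 (hsub u x0)). pose proof (hnorm_ge0 (gf x0)).
      pose proof (hnorm_ge0 z0). pose proof (sqrt_pos V0).
      assert (0 <= tau * (hnorm (gf x0) + L * sqrt V0)) by (apply Rmult_le_pos; nra). lra. }
    set (d := Rmin (eps / 2) (tau * eps / (2 * (M + 1)))).
    assert (Hte : 0 < tau * eps) by (apply Rmult_lt_0_compat; lra).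
    assert (Hd : 0 < d) by (apply Rmin_glb_lt; [|apply Rdiv_lt_0_compat]; lra).
    assert (Hd1 : d <= eps / 2) by apply Rmin_l.
    assert (Hd2 : 2 * d * M <= tau * eps).
    { apply Rle_trans with (2 * (tau * eps / (2 * (M + 1))) * M).
      - apply Rmult_le_compat_r; [exact HM|]. pose proof (Rmin_r (eps / 2) (tau * eps / (2 * (M + 1)))).
        fold d in H0. lra.
      - apply Rmult_le_reg_r with (M + 1); [lra|].
        replace (2 * (tau * eps / (2 * (M + 1))) * M * (M + 1)) with (tau * eps * M)
          by (field; lra). nra. }
    destruct (Res d Hd) as [N HN]. exists N. intros k HkN.
    destruct (HN k HkN) as [R1 [R2 R3]].
    assert (Dx : hnorm (hsub (x k) (x (S k))) < 2 * d).
    { pose proof (hnorm_sub_triangle (x k) (v k) (x (S k))) as T.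
      rewrite (hnorm_sub_sym (v k)) in T. lra. }
    assert (Db : hnorm (hsub (b k) (K (x (S k)))) < 2 * d).
    { replace (hsub (b k) (K (x (S k))))
        with (hadd (hsub (z k) (z (S k))) (K (hsub (v k) (x (S k))))).
      2:{ rewrite (adjoint_sub K Ks HK). unfold b. vec. }
      pose proof (hnorm_triangle (hsub (z k) (z (S k))) (K (hsub (v k) (x (S k))))) as T.
      pose proof (HKn (hsub (v k) (x (S k)))).
      rewrite (hnorm_sub_sym (z k)) in T. rewrite (hnorm_sub_sym (v k)) in *. lra. }
    split; [lra|]. split; [lra|].
    destruct (Hx k) as [a [Ea Ha]]. destruct (Hz k) as [a' [Ea' Ha']]. fold (b k) in Ea', Ha'.
    destruct HG as [[_ Pg] _]. destruct HH as [[_ Ph] _].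
    unfold Phi, sum_fun in *. simpl in *. rewrite Ea, Ea'. simpl.
    pose proof (Pg u). pose proof (Ph q).
    destruct (g u) as [cu| |] eqn:Eu; [|easy|easy].
    destruct (h q) as [cq| |] eqn:Eq; [|easy|easy].
    simpl in Hr. specialize (Ha u cu Eu). specialize (Ha' q cq Eq).
    pose proof (gradient_ineq f gf Hc Hgrad (x k) u) as Hf.
    apply Rmult_le_reg_l with tau; [lra|].
    rewrite Rmult_minus_distr_l, <- Rmult_assoc, Rinv_r, Rmult_1_l by lra.
    apply Rmult_le_compat_l with (r := tau) in Hf; [|lra].
    apply Rmult_le_compat_l with (r := tau) in Hr; [|lra].
    assert (Err : - (tau * eps) <= inner (hsub (x k) (x (S k))) (hsub u (x (S k)))
       + tau * inner (gf (x k)) (hsub (x (S k)) (x k))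
       + inner (z (S k)) (hsub (K (x (S k))) (b k))).
    { pose proof (inner_ge_norms (hsub (x k) (x (S k))) (hsub u (x (S k)))) as I1.
      pose proof (inner_ge_norms (gf (x k)) (hsub (x (S k)) (x k))) as I2.
      pose proof (inner_ge_norms (z (S k)) (hsub (K (x (S k))) (b k))) as I3.
      rewrite (hnorm_sub_sym (x (S k))) in I2. rewrite (hnorm_sub_sym (K (x (S k)))) in I3.
      pose proof (Rmult_le_compat _ _ _ _ (hnorm_ge0 _) (hnorm_ge0 _)
                    (Rlt_le _ _ Dx) (Bx (S k) u)) as J1.
      pose proof (Rmult_le_compat _ _ _ _ (hnorm_ge0 _) (hnorm_ge0 _)
                    (Bg k) (Rlt_le _ _ Dx)) as J2.
      pose proof (Rmult_le_compat _ _ _ _ (hnorm_ge0 _) (hnorm_ge0 _)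
                    (Bz (S k)) (Rlt_le _ _ Db)) as J3.
      assert (I2' : - ((hnorm (gf x0) + L * sqrt V0) * (2 * d))
                    <= inner (gf (x k)) (hsub (x (S k)) (x k))) by lra.
      apply Rmult_le_compat_l with (r := tau) in I2'; [|lra].
      unfold M in Hd2. lra. }
    assert (A : forall p y, inner (Ks p) y = inner (K y) p).
    { intros p y. rewrite HK. apply inner_sym. }
    clear - Ha Ha' Hf Hr Err A. clearbody b.
    revert Ha Ha' Hf Hr Err. expand. rewrite !A. orient. intros. lra. }
  destruct (fejer_weak_cv X (fun p => kkt tau gf g h K Ks (fst p) (snd p)))
    as [[xs zs] [Hkkt Hweak]].
  - now exists (x0, z0).
  - intros [xs zs] k Hs. pose proof (step xs zs k Hs) as S1.
    eapply Rle_trans; [|exact S1].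
    rewrite <- Rplus_0_r at 1. apply Rplus_le_compat_l, Rmult_le_pos; [lra|].
    repeat apply Rplus_le_le_0_compat; apply inner_pos.
  - intros [xs zs] Hcl. simpl.
    apply saddle_kkt with (f := f) (L := L); try assumption; [lra|].
    intros u q r Hr. change (Ele (Phi (u, (u, q))) (Fin r)) in Hr.
    change (Ele (Phi (xs, (xs, K xs))) (Fin (r - / tau * inner zs (hsub q (K u))))).
    set (e := hsub q (K u)). apply Ele_eps. intros eps He.
    apply lsc_adherent; [exact LPhi|]. intros d Hd.
    (* Collects the two errors of size dl: the slack in [Approx], and the change of the linear term
       when z moves by dl. *)
    set (W := 1 + / tau * hnorm e).
    assert (Htau' : 0 < / tau) by (apply Rinv_0_lt_compat; lra).
    assert (HW : 0 < W).
    { unfold W. pose proof (Rmult_le_pos _ _ (Rlt_le _ _ Htau') (hnorm_ge0 e)). lra. }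
    (* Each component is within 2 dl of its limit, and the bound d is halved at each of the two
       nested pairs. *)
    set (dl := Rmin (d / 8) (eps / W)).
    assert (Hdl : 0 < dl) by (apply Rmin_glb_lt; [|apply Rdiv_lt_0_compat]; lra).
    assert (Hdl1 : dl <= d / 8) by apply Rmin_l.
    assert (Hdl2 : dl * W <= eps).
    { apply Rle_trans with (eps / W * W).
      - apply Rmult_le_compat_r; [lra | apply Rmin_r].
      - apply Req_le. field. lra. }
    destruct (Approx u q r Hr dl Hdl) as [N HN].
    (* Existential arguments for f and h make [Q] the projection of a convex set, hence convex, so
       it passes from the tail to its hull. *)
    pose (Q := fun p : prodH H G => exists x' b',
      hnorm (hsub x' (fst p)) <= dl /\ hnorm (hsub b' (K (fst p))) <= dl /\
      Ele (Phi (x', (fst p, b'))) (Fin (r + dl - / tau * inner (snd p) e))).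
    (* The shift is needed because the iterate of index [S k] is paired with [x k] and [b k]. *)
    destruct (Hcl (S N) dl Hdl) as [p [Hp Hpc]].
    assert (HQ : Q p).
    { apply Hp.
      - intros p1 p2 t Ht [x1 [b1 [A1 [B1 C1]]]] [x2 [b2 [A2 [B2 C2]]]].
        exists (hadd (hscal t x1) (hscal (1 - t) x2)), (hadd (hscal t b1) (hscal (1 - t) b2)).
        simpl. split; [|split].
        + now apply hnorm_comb_le.
        + rewrite (adjoint_comb K Ks HK). now apply hnorm_comb_le.
        + pose proof (CPhi _ _ _ _ t Ht C1 C2) as C.
          eapply Ele_trans_fin; [exact C|]. apply Req_le.
          rewrite inner_add, !inner_scal. ring.
      - intros y [k [Hk1 ->]]. destruct k as [|k]; [lia|].
        destruct (HN k ltac:(lia)) as [A1 [B1 C1]].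
        exists (x k), (b k). simpl. split; [lra|]. split; [lra | exact C1]. }
    destruct HQ as [x' [b' [A1 [B1 C1]]]].
    exists (x', (fst p, b')). split.
    + eapply Ele_trans_fin; [exact C1|].
      pose proof (hnorm_snd_le (hsub p (xs, zs))) as F2.
      change (hnorm (hsub (snd p) zs) <= hnorm (hsub p (xs, zs))) in F2.
      pose proof (inner_ge_norms (hsub (snd p) zs) e) as I.
      assert (hnorm (hsub (snd p) zs) * hnorm e <= dl * hnorm e).
      { apply Rmult_le_compat_r; [apply hnorm_ge0|]. lra. }
      assert (I' : - (dl * hnorm e) <= inner (snd p) e - inner zs e).
      { unfold hsub at 2 in I. rewrite inner_add, inner_oppl in I. lra. }
      apply Rmult_le_compat_l with (r := / tau) in I'; [|lra].
      unfold W in Hdl2. lra.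
    + pose proof (hnorm_fst_le (hsub p (xs, zs))) as F1.
      change (hnorm (hsub (fst p) xs) <= hnorm (hsub p (xs, zs))) in F1.
      pose proof (hnorm_sub_triangle x' (fst p) xs) as T1.
      pose proof (hnorm_sub_triangle b' (K (fst p)) (K xs)) as T2.
      rewrite <- (adjoint_sub K Ks HK (fst p)) in T2. pose proof (HKn (hsub (fst p) xs)).
      apply (@hnorm_pair_lt H (prodH H G) (hsub x' xs) (hsub (fst p) xs, hsub b' (K xs)));
        [exact Hd | lra |].
      apply (@hnorm_pair_lt H G (hsub (fst p) xs) (hsub b' (K xs))); lra.
  - exists xs, zs. split; [exact Hkkt|].
    intros y. pose proof (Hweak (y, hzero)) as Hy.
    intros eps He. destruct (Hy eps He) as [N HN]. exists N. intros n Hn.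
    specialize (HN n Hn). simpl in HN. rewrite !inner_0r, !Rplus_0_r in HN. exact HN.
Qed.

(** * Finitely many dual variables *)

Fixpoint PG (G : nat -> Hilbert) (n : nat) : Hilbert :=
  match n with O => unitH | S n' => prodH (PG G n') (G n') end.

Fixpoint tup {G : nat -> Hilbert} (n : nat) (F : forall i, G i) : PG G n :=
  match n with O => tt | S n' => (tup n' F, F n') end.

Fixpoint dual_sum {H : Hilbert} {G : nat -> Hilbert} (s : nat -> R) (Bs : forall i, G i -> H)
  (n : nat) : PG G n -> H :=
  match n with
  | O => fun _ => hzero
  | S n' => fun q => hadd (dual_sum s Bs n' (fst q)) (hscal (s n') (Bs n' (snd q)))
  end.

(** Dividing by [s] undoes the scaling in the operator x |-> (s i B_i x), so that composing with it
    gives the sum of the h_i (B_i x). *)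
Fixpoint sep_sum {G : nat -> Hilbert} (s : nat -> R) (h : forall i, G i -> ERbar)
  (n : nat) : PG G n -> ERbar :=
  match n with
  | O => fun _ => Fin 0
  | S n' => sum_fun (sep_sum s h n') (fun q => h n' (hscal (/ s n') q))
  end.

Lemma tup_adjoint {H : Hilbert} {G : nat -> Hilbert} (s : nat -> R)
  (B : forall i, H -> G i) (Bs : forall i, G i -> H) (n : nat) :
  (forall i, (i < n)%nat -> is_adjoint (B i) (Bs i)) ->
  is_adjoint (fun x => tup n (fun i => hscal (s i) (B i x))) (dual_sum s Bs n).
Proof.
  induction n as [|n IH]; intros HB x q; simpl.
  - now rewrite inner_0r.
  - rewrite inner_addr, inner_scal, inner_scalr.
    rewrite <- (IH (fun i Hi => HB i (Nat.lt_lt_succ_r _ _ Hi))).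
    now rewrite (HB n (Nat.lt_succ_diag_r n)).
Qed.

Lemma inner_tup {G : nat -> Hilbert} (n : nat) (F F' : forall i, G i) :
  inner (tup n F) (tup n F') = rsum n (fun i => inner (F i) (F' i)).
Proof. induction n as [|n IH]; simpl; [reflexivity | now rewrite IH]. Qed.

Lemma tup_add_sub {G : nat -> Hilbert} (n : nat) (F F' F'' : forall i, G i) :
  hadd (hsub (tup n F) (tup n F')) (tup n F'')
  = tup n (fun i => hadd (hsub (F i) (F' i)) (F'' i)).
Proof. induction n as [|n IH]; [reflexivity|]. simpl. now rewrite <- IH. Qed.

Lemma dual_sum_tup {H : Hilbert} {G : nat -> Hilbert} (s : nat -> R)
  (Bs : forall i, G i -> H) (n : nat) (F : forall i, G i) :
  dual_sum s Bs n (tup n F) = hsum n (fun i => hscal (s i) (Bs i (F i))).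
Proof. induction n as [|n IH]; simpl; [reflexivity | now rewrite IH]. Qed.

Lemma sep_sum_tup {G : nat -> Hilbert} (s : nat -> R) (h : forall i, G i -> ERbar)
  (n : nat) (F : forall i, G i) :
  sep_sum s h n (tup n F) = Esum n (fun i => h i (hscal (/ s i) (F i))).
Proof.
  induction n as [|n IH]; simpl; [reflexivity|]. unfold sum_fun. simpl. now rewrite IH.
Qed.

Lemma hsum_scal_ext {H : Hilbert} (c : R) (n : nat) (F F' : nat -> H) :
  (forall i, (i < n)%nat -> F i = hscal c (F' i)) -> hsum n F = hscal c (hsum n F').
Proof.
  induction n as [|n IH]; intros E; simpl.
  - vec.
  - rewrite IH, E by (auto with arith). vec.
Qed.

Lemma Esum_ext (n : nat) (F F' : nat -> ERbar) :
  (forall i, (i < n)%nat -> F i = F' i) -> Esum n F = Esum n F'.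
Proof.
  induction n as [|n IH]; intros E; simpl; [reflexivity|].
  rewrite IH, E by (auto with arith). reflexivity.
Qed.

Lemma rsum_le (n : nat) (F F' : nat -> R) :
  (forall i, (i < n)%nat -> F i <= F' i) -> rsum n F <= rsum n F'.
Proof.
  induction n as [|n IH]; intros E; simpl; [lra|].
  apply Rplus_le_compat; [apply IH; auto with arith | apply E; auto with arith].
Qed.

Lemma rsum_scal (c : R) (n : nat) (F : nat -> R) :
  rsum n (fun i => c * F i) = c * rsum n F.
Proof. induction n as [|n IH]; simpl; [ring|]. rewrite IH. ring. Qed.

Lemma Gamma0_scaled_arg {H : Hilbert} (phi : H -> ERbar) (c : R) :
  c <> 0 -> Gamma0 phi -> Gamma0 (fun q => phi (hscal c q)).
Proof.
  intros Hc0 [[[x0 Hx0] Pm] [Hc Hl]]. split; [split|split].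
  - exists (hscal (/ c) x0). rewrite hscal_assoc, Rinv_r, hscal_one by exact Hc0. exact Hx0.
  - intro x. apply Pm.
  - intros x y a b t Ht Ha Hb.
    replace (hscal c (hadd (hscal t x) (hscal (1 - t) y)))
      with (hadd (hscal t (hscal c x)) (hscal (1 - t) (hscal c y))) by vec.
    now apply Hc.
  - intros r u l Hu Hcv. apply Hl with (fun n => hscal c (u n)); [exact Hu|].
    pose proof (Rabs_pos_lt c Hc0) as Pc.
    intros eps He. destruct (Hcv (eps / Rabs c)) as [N HN].
    { now apply Rdiv_lt_0_compat. }
    exists N. intros n Hn. specialize (HN n Hn).
    replace (hsub (hscal c (u n)) (hscal c l)) with (hscal c (hsub (u n) l)) by vec.
    rewrite hnorm_scal. apply Rmult_lt_compat_l with (r := Rabs c) in HN; [|exact Pc].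
    replace (Rabs c * (eps / Rabs c)) with eps in HN by (field; lra). exact HN.
Qed.

Lemma sep_sum_Gamma0 {G : nat -> Hilbert} (s : nat -> R) (h : forall i, G i -> ERbar)
  (n : nat) :
  (forall i, (i < n)%nat -> 0 < s i) -> (forall i, (i < n)%nat -> Gamma0 (h i)) ->
  Gamma0 (sep_sum s h n).
Proof.
  induction n as [|n IH]; intros Hs Hh.
  - split; [split|split].
    + now exists tt.
    + discriminate.
    + intros x y a b t Ht Ha Hb. simpl in *. nra.
    + intros c u l Hu _. exact (Hu O).
  - simpl. apply sum_fun_Gamma0; [apply IH; auto with arith|].
    apply Gamma0_scaled_arg; [|auto with arith].
    apply Rinv_neq_0_compat. specialize (Hs n (Nat.lt_succ_diag_r n)). lra.
Qed.

(** Chain rule for the scaling: subgradients of h_i (q / s_i) are those of h_i divided by s_i, and a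
    separable sum is treated componentwise. *)
Lemma sep_sum_scaled_subdiff {G : nat -> Hilbert} (tau : R) (s : nat -> R)
  (h : forall i, G i -> ERbar) (n : nat) (F F' : forall i, G i) :
  (forall i, (i < n)%nat -> 0 < s i) -> (forall i, (i < n)%nat -> Gamma0 (h i)) ->
  (forall i, (i < n)%nat ->
     scaled_subdiff tau (h i) (hscal (/ s i) (F i)) (hscal (s i) (F' i))) ->
  scaled_subdiff tau (sep_sum s h n) (tup n F) (tup n F').
Proof.
  induction n as [|n IH]; intros Hs Hh Hsub.
  - exists 0. split; [reflexivity|]. intros u c Ec. injection Ec as <-. simpl. lra.
  - destruct IH as [a [Ea Ha]]; [auto with arith..|].
    assert (GS : Gamma0 (sep_sum s h n)) by (apply sep_sum_Gamma0; auto with arith).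
    destruct GS as [[_ PS] _]. destruct (Hh n (Nat.lt_succ_diag_r n)) as [[_ Ph] _].
    specialize (Hs n (Nat.lt_succ_diag_r n)).
    destruct (Hsub n (Nat.lt_succ_diag_r n)) as [a' [Ea' Ha']].
    exists (a + a'). simpl. unfold sum_fun. simpl. rewrite Ea, Ea'. split; [reflexivity|].
    intros [u1 u2] c Ec. simpl in *.
    specialize (PS u1). specialize (Ph (hscal (/ s n) u2)).
    destruct (sep_sum s h n u1) as [c1| |] eqn:E1; try easy;
    destruct (h n (hscal (/ s n) u2)) as [c2| |] eqn:E2; try easy.
    injection Ec as <-.
    specialize (Ha u1 c1 E1). specialize (Ha' _ c2 E2).
    replace (hsub (hscal (/ s n) u2) (hscal (/ s n) (F n)))
      with (hscal (/ s n) (hsub u2 (F n))) in Ha' by vec.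
    rewrite inner_scal, inner_scalr, <- Rmult_assoc, Rinv_r, Rmult_1_l in Ha' by lra.
    unfold hsub in *. lra.
Qed.

Lemma scaled_subdiff_mul {H : Hilbert} (tau c : R) (phi : H -> ERbar) (p s : H) :
  0 < c -> scaled_subdiff tau phi p s -> scaled_subdiff (c * tau) phi p (hscal c s).
Proof.
  intros Hc [a [Ea Ha]]. exists a. split; [exact Ea|].
  intros u r Er. specialize (Ha u r Er). rewrite inner_scal.
  apply Rmult_le_compat_l with (r := c) in Ha; lra.
Qed.

Lemma adjoint_scal {H G : Hilbert} (K : H -> G) (Ks : G -> H) :
  is_adjoint K Ks -> forall a y, Ks (hscal a y) = hscal a (Ks y).
Proof.
  intros HK a y. apply inner_ext. intro z.
  rewrite (inner_sym _ (Ks _)), <- HK, inner_scalr, inner_scal, (inner_sym _ (Ks y)), <- HK.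
  reflexivity.
Qed.

Lemma opnorm_sq_bound {H G : Hilbert} (B : H -> G) (nB : R) :
  bounded_linear B -> is_opnorm B nB ->
  forall x, inner (B x) (B x) <= nB ^ 2 * inner x x.
Proof.
  intros [_ [Bscal _]] [Hub _] x.
  assert (N : hnorm (B x) <= nB * hnorm x).
  { destruct (Req_dec (hnorm x) 0) as [Z|Z].
    - assert (Ex : x = hzero).
      { apply inner_def. rewrite <- hnorm_sq, Z. ring. }
      assert (EB : B x = hscal 0 (B x)).
      { rewrite <- Bscal. f_equal. rewrite Ex. vec. }
      rewrite EB, hnorm_scal, Rabs_R0, Z. lra.
    - pose proof (hnorm_ge0 x) as P.
      assert (E : hnorm (B (hscal (/ hnorm x) x)) <= nB).
      { apply Hub. exists (hscal (/ hnorm x) x). split; [|reflexivity].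
        rewrite hnorm_scal, Rabs_inv, Rabs_pos_eq, Rinv_l by lra. lra. }
      rewrite Bscal, hnorm_scal, Rabs_inv, Rabs_pos_eq in E by lra.
      apply Rmult_le_compat_r with (r := hnorm x) in E; [|exact P].
      rewrite Rmult_comm, <- Rmult_assoc, Rinv_r in E by exact Z. lra. }
  pose proof (Rmult_le_compat _ _ _ _ (hnorm_ge0 (B x)) (hnorm_ge0 (B x)) N N) as Q.
  rewrite hnorm_sq in Q. rewrite <- (hnorm_sq x). lra.
Qed.

Theorem theorem4p2
  (H : Hilbert) (m : nat) (G : nat -> Hilbert)
  (f : H -> R) (gradf : H -> H) (L : R)
  (g : H -> ERbar)
  (h : forall i, G i -> ERbar)
  (B : forall i, H -> G i) (Bs : forall i, G i -> H) (nB : nat -> R)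
  (* standing assumptions *)
  (HL : 0 < L)
  (Hfconv : convex_real f) (Hgrad : is_gradient f gradf) (Hlip : lipschitz gradf L)
  (Hg : Gamma0 g)
  (Hh : forall i, (i < m)%nat -> Gamma0 (h i))
  (HB : forall i, (i < m)%nat -> bounded_linear (B i))
  (HBs : forall i, (i < m)%nat -> is_adjoint (B i) (Bs i))
  (HnB : forall i, (i < m)%nat -> is_opnorm (B i) (nB i))
  (Hexist : exists (xh : H) (u : H) (z : forall i, G i),
      subdiff g xh u /\
      (forall i, (i < m)%nat -> subdiff (h i) (B i xh) (z i)) /\
      hadd (hadd (gradf xh) u) (hsum m (fun i => Bs i (z i))) = hzero)
  (* parameters *)
  (w : nat -> R) (gam lam : R)
  (Hw : forall i, (i < m)%nat -> 0 < w i < 1)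
  (Hwsum : rsum m w = 1)
  (Hgam : 0 < gam < 2 / L)
  (Hlam : 0 < lam /\ lam * rsum m (fun i => w i * (nB i) ^ 2) < 1)
  (* iterates *)
  (x v : nat -> H) (y : nat -> forall i, G i)
  (Hv : forall k, is_prox gam g
          (hsub (hsub (x k) (hscal gam (gradf (x k))))
                (hscal gam (hsum m (fun i => hscal (w i) (Bs i (y k i))))))
          (v k))
  (Hy : forall k i, (i < m)%nat -> exists p,
          is_prox (w i * (lam / gam)) (fconj (h i))
            (hscal (w i) (hadd (y k i) (hscal (lam / gam) (B i (v k))))) p /\
          y (S k) i = hscal (/ w i) p)
  (Hx : forall k, is_prox gam g
          (hsub (hsub (x k) (hscal gam (gradf (x k))))
                (hscal gam (hsum m (fun i => hscal (w i) (Bs i (y (S k) i))))))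
          (x (S k))) :
  exists xs : H,
    (forall z : H,
       Ele (Eplus (Eplus (Fin (f xs)) (g xs)) (Esum m (fun i => h i (B i xs))))
           (Eplus (Eplus (Fin (f z)) (g z)) (Esum m (fun i => h i (B i z))))) /\
    weak_cv x xs.
Proof.
  destruct Hexist as [xh [uh [zh [Hgh [Hhh Hsum]]]]]. destruct Hlam as [Hlam Hkap].
  assert (Hwl : forall i, (i < m)%nat -> 0 < w i * lam).
  { intros i Hi. apply Rmult_lt_0_compat; [now apply Hw | exact Hlam]. }
  (* Rescaling [w_i y_i] by [gam / s i] absorbs the dual step sizes [w_i lam / gam]
     and the factor [gam] into the operator [x |-> (s i B_i x)_i]. *)
  pose (s := fun i => sqrt (w i * lam)).
  assert (Hs : forall i, (i < m)%nat -> 0 < s i).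
  { intros i Hi. apply sqrt_lt_R0. auto. }
  assert (Hss : forall i, (i < m)%nat -> s i * s i = w i * lam).
  { intros i Hi. apply sqrt_sqrt. apply Rlt_le. auto. }
  pose (K := fun a => tup m (fun i => hscal (s i) (B i a))).
  pose (Z := fun k i => hscal (gam / s i) (hscal (w i) (y k i))).
  assert (HK : is_adjoint K (dual_sum s Bs m)) by now apply tup_adjoint.
  assert (Gh : Gamma0 (sep_sum s h m)) by now apply sep_sum_Gamma0.
  assert (KsE : forall F : forall i, G i,
    dual_sum s Bs m (tup m (fun i => hscal (gam / s i) (F i)))
    = hscal gam (hsum m (fun i => Bs i (F i)))).
  { intros F. rewrite dual_sum_tup. apply hsum_scal_ext. intros i Hi.
    rewrite (adjoint_scal _ _ (HBs i Hi)), hscal_assoc. f_equal.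
    specialize (Hs i Hi). field. lra. }
  assert (KsZ : forall k, dual_sum s Bs m (tup m (Z k))
    = hscal gam (hsum m (fun i => hscal (w i) (Bs i (y k i))))).
  { intros k. unfold Z. rewrite KsE. f_equal.
    transitivity (hscal 1 (hsum m (fun i => hscal (w i) (Bs i (y k i)))));
      [|apply hscal_one].
    apply hsum_scal_ext. intros i Hi.
    now rewrite hscal_one, (adjoint_scal _ _ (HBs i Hi)). }
  destruct (primal_dual_weak_cv f gradf L gam g (sep_sum s h m) K (dual_sum s Bs m)
    (lam * rsum m (fun i => w i * nB i ^ 2)) x v (fun k => tup m (Z k)))
    as [xs [zs [[Hks1 Hks2] Hcv]]]; try assumption.
  - split; [|exact Hkap]. apply Rmult_le_pos; [lra|].
    replace 0 with (rsum m (fun i => 0 * 0)) by (rewrite rsum_scal; ring).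
    apply rsum_le. intros i Hi. specialize (Hw i Hi). pose proof (pow2_ge_0 (nB i)). nra.
  (* Since s_i^2 = w_i lam, |K a|^2 is lam times the sum of the w_i |B_i a|^2. *)
  - intros a. unfold K. rewrite inner_tup.
    rewrite Rmult_assoc, (Rmult_comm (rsum _ _)), <- Rmult_assoc, <- rsum_scal.
    apply rsum_le. intros i Hi.
    rewrite inner_scal, inner_scalr, <- Rmult_assoc, (Hss i Hi).
    pose proof (opnorm_sq_bound (B i) (nB i) (HB i Hi) (HnB i Hi) a) as Q.
    apply Rmult_le_compat_l with (r := w i * lam) in Q; [lra|].
    apply Rlt_le. auto.
  (* The given multipliers [zh i] correspond to the weighted variables w_i y_i, hence the same
     factor gam / s i and no weight. *)
  - exists xh, (tup m (fun i => hscal (gam / s i) (zh i))). split.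
    + rewrite KsE.
      replace (hopp (hadd (hscal gam (gradf xh)) (hscal gam (hsum m (fun i => Bs i (zh i))))))
        with (hscal gam uh); [now apply subdiff_scaled|].
      apply inner_ext. intro q.
      assert (E : inner (hadd (hadd (gradf xh) uh) (hsum m (fun i => Bs i (zh i)))) q = 0)
        by (rewrite Hsum; apply inner_0l).
      rewrite !inner_add in E. rewrite inner_oppl, inner_add, !inner_scal.
      replace (inner uh q) with (- inner (gradf xh) q
        - inner (hsum m (fun i => Bs i (zh i))) q) by lra. ring.
    + apply sep_sum_scaled_subdiff; try assumption. intros i Hi. specialize (Hs i Hi).
      rewrite !hscal_assoc, Rinv_l, hscal_one by lra.
      replace (s i * (gam / s i)) with gam by (field; lra).
      apply subdiff_scaled; [lra | auto].
  - intros k. rewrite KsZ.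
    pose proof Hg as [Hp [Hc _]].
    pose proof (prox_scaled_subdiff _ _ _ _ (proj1 Hgam) Hp Hc (Hv k)) as P.
    match type of P with scaled_subdiff _ _ _ ?a =>
      match goal with |- scaled_subdiff _ _ _ ?b => replace b with a by vec end end.
    exact P.
  - intros k. rewrite KsZ.
    pose proof Hg as [Hp [Hc _]].
    pose proof (prox_scaled_subdiff _ _ _ _ (proj1 Hgam) Hp Hc (Hx k)) as P.
    match type of P with scaled_subdiff _ _ _ ?a =>
      match goal with |- scaled_subdiff _ _ _ ?b => replace b with a by vec end end.
    exact P.
  - intros k. unfold K. rewrite tup_add_sub.
    apply sep_sum_scaled_subdiff; try assumption. intros i Hi.
    destruct (Hy k i Hi) as [p [Hp Ey]].
    specialize (Hs i Hi). specialize (Hss i Hi). specialize (Hwl i Hi).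
    specialize (Hw i Hi).
    assert (Hmu : 0 < w i * (lam / gam)).
    { apply Rmult_lt_0_compat; [lra|]. apply Rdiv_lt_0_compat; lra. }
    pose proof (prox_conj_subdiff _ _ _ _ _ _ Hmu (Hh i Hi) (Hhh i Hi) Hp) as P.
    apply (scaled_subdiff_mul 1 gam) in P; [|lra]. rewrite Rmult_1_r in P.
    assert (Ep : hscal (w i) (y (S k) i) = p).
    { rewrite Ey, hscal_assoc, Rinv_r by lra. apply hscal_one. }
    unfold Z. rewrite Ep.
    replace (hscal (s i) (hscal (gam / s i) p)) with (hscal gam p).
    2:{ rewrite hscal_assoc. f_equal. field. lra. }
    match type of P with scaled_subdiff _ _ ?a _ =>
      match goal with |- scaled_subdiff _ _ ?b _ => replace b with a; [exact P|] end end.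
    (* Both points equal B_i v + (gam / lam) (y_i^k - y_i^{k+1}), by s_i^2 = w_i lam. *)
    apply inner_ext. intro q. expand.
    replace lam with (s i * s i / w i) by (rewrite Hss; field; lra).
    field. repeat split; lra.
  - exists xs. split; [|exact Hcv]. intros u.
    assert (HE : forall a, Esum m (fun i => h i (B i a)) = sep_sum s h m (K a)).
    { intros a. unfold K. rewrite sep_sum_tup. apply Esum_ext. intros i Hi.
      specialize (Hs i Hi). rewrite hscal_assoc, Rinv_l, hscal_one by lra. reflexivity. }
    rewrite !HE.
    destruct Hks1 as [a [Ea Ha]]. destruct Hks2 as [a' [Ea' Ha']].
    destruct Hg as [[_ Pg] _]. destruct Gh as [[_ Ph] _].
    specialize (Pg u). specialize (Ph (K u)). rewrite Ea, Ea'.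
    destruct (g u) as [c| |] eqn:Ec; [|exact I|easy].
    destruct (sep_sum s h m (K u)) as [c'| |] eqn:Ec'; [|exact I|easy].
    simpl. specialize (Ha u c Ec). specialize (Ha' (K u) c' Ec').
    (* Adding the inequalities for f, g and h cancels all linear terms: the gradient against its
       opposite, and the dual terms through the adjoint. *)
    pose proof (gradient_ineq f gradf Hfconv Hgrad xs u) as Hf.
    rewrite <- (adjoint_sub K _ HK), inner_sym, HK, inner_sym in Ha'.
    rewrite inner_oppl, inner_add, inner_scal in Ha.
    apply Rmult_le_reg_l with gam; [lra|].
    apply Rmult_le_compat_l with (r := gam) in Hf; [|lra].
    lra.
Qed.
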